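(* For the popular matching problem with strictly ordered preference lists, there is an NC algorithm (polylogarithmic parallel time with polynomially many processors) that either finds a maximum-cardinality popular matching or determines that no popular matching exists.
   Context: An instance consists of applicants $\mathcal{A}$, posts $\mathcal{P}$, and for each applicant $a$ a strictly ordered preference list over a non-empty subset of $\mathcal{P}$. For each applicant $a$ a unique last resort post $l(a)$ is added at the end of $a$'s list (ranked worse than every other post on it), so every applicant can be assumed matched; matchings are taken to be applicant-complete (every applicant matched), and the size of a matching is the number of applicants not matched to their last resort post. An applicant $a$ prefers matching $M'$ to $M$ if $a$ prefers $M'(a)$ to $M(a)$. With $P(M,M')$ the set of applicants preferring $M$ to $M'$, $M'$ is more popular than $M$ if $|P(M',M)|>|P(M,M')|$; $M$ is popular if no matching is more popular than it. A maximum-cardinality popular matching is a popular matching of largest size. *)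

(* Defs.v *)
From mathcomp Require Import all_boot.
Set Implicit Arguments.
Unset Strict Implicit.
Unset Printing Implicit Defensive.

(* The list [pref a] enumerates the posts acceptable to [a], best first. *)
Record instance : Type := Instance {
  napp : nat;
  npost : nat;
  pref : 'I_napp -> seq 'I_npost;
  pref_uniq : forall a, uniq (pref a);
  pref_nonempty : forall a, pref a != [::]
}.

Section PopularMatching.
Variable I : instance.

(* [inl p] is an original post, [inr a] is the last resort post l(a). *)
Definition post : finType := ('I_(npost I) + 'I_(napp I))%type.

Definition last_resort (a : 'I_(napp I)) : post := inr a.

Definition plist (a : 'I_(napp I)) : seq post :=
  rcons [seq inl p | p <- pref a] (last_resort a).

Definition assignment := {ffun 'I_(napp I) -> post}.

Definition is_matching (M : assignment) : Prop :=
  injective M /\ forall a, M a \in plist a.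

Definition matching_size (M : assignment) : nat :=
  #|[set a | M a != last_resort a]|.

(* On [plist a] a smaller index means a better post. *)
Definition prefers (a : 'I_(napp I)) (p q : post) : bool :=
  index p (plist a) < index q (plist a).

(* P(M, M') *)
Definition preferring (M M' : assignment) : {set 'I_(napp I)} :=
  [set a | prefers a (M a) (M' a)].

Definition more_popular (M' M : assignment) : Prop :=
  #|preferring M M'| < #|preferring M' M|.

Definition popular (M : assignment) : Prop :=
  is_matching M /\ forall M', is_matching M' -> ~ more_popular M' M.

Definition max_popular (M : assignment) : Prop :=
  popular M /\ forall M', popular M' -> matching_size M' <= matching_size M.

End PopularMatching.

(* An unbounded shared memory of natural numbers; a processor is identified by
   its index [pid]. *)
Definition mem := nat -> nat.

Inductive binop : Type := OAdd | OSub | OMul | ODiv | OMod | OLt | OEq.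

(* [OSub] is truncated at 0, and division follows [divn] and [modn]. *)
Definition eval_op (o : binop) (x y : nat) : nat :=
  match o with
  | OAdd => x + y
  | OSub => x - y
  | OMul => x * y
  | ODiv => x %/ y
  | OMod => x %% y
  | OLt => x < y
  | OEq => x == y
  end.

Inductive expr : Type :=
  | Const of nat
  | Pid
  | Read of expr
  | Bin of binop & expr & expr.

Fixpoint eval (s : mem) (pid : nat) (e : expr) : nat :=
  match e with
  | Const c => c
  | Pid => pid
  | Read e1 => s (eval s pid e1)
  | Bin o e1 e2 => eval_op o (eval s pid e1) (eval s pid e2)
  end.

(* One synchronous instruction on P processors: every processor whose guard [g]
   is nonzero writes the value of [v] to the address [a], all three being
   evaluated in the memory preceding the instruction.  Reads are concurrent, and
   concurrent writes to a cell are resolved in favour of the lowest index. *)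
Definition par_step (P : nat) (g a v : expr) (s : mem) : mem := fun x =>
  if [seq p <- iota 0 P | (eval s p g != 0) && (eval s p a == x)] is p :: _
  then eval s p v else s x.

(* Control flow is common to all processors; processors diverge through guards
   and through indirect addressing. *)
Inductive prog : Type :=
  | Par (g a v : expr)
  | Seq (c1 c2 : prog)
  | While (b : expr) (c : prog).

(* [run P W c s t s']: started in memory [s] on [P] processors, the program [c]
   halts after [t] time units in memory [s'], and no memory cell exceeds [W]
   after any instruction.  As a program is a fixed finite object, each time unit
   comprises a bounded number of elementary operations of every processor.  The
   bound [W] keeps machine words at O(log W) bits, so that unit cost arithmetic,
   multiplication and division included, is legitimate.  Loop tests are
   evaluated by processor 0. *)
Inductive run (P W : nat) : prog -> mem -> nat -> mem -> Prop :=
  | run_par g a v s :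
      (forall x, par_step P g a v s x <= W) ->
      run P W (Par g a v) s 1 (par_step P g a v s)
  | run_seq c1 c2 s t1 s1 t2 s2 :
      run P W c1 s t1 s1 -> run P W c2 s1 t2 s2 ->
      run P W (Seq c1 c2) s (t1 + t2) s2
  | run_while_false b c s :
      eval s 0 b = 0 -> run P W (While b c) s 1 s
  | run_while_true b c s t1 s1 t2 s2 :
      eval s 0 b <> 0 -> run P W c s t1 s1 -> run P W (While b c) s1 t2 s2 ->
      run P W (While b c) s (1 + t1 + t2) s2.

(* The memory holding [w] from address 0 on, and 0 elsewhere. *)
Definition load (w : seq nat) : mem := fun x => nth 0 w x.

Definition poly_bound (k N : nat) : nat := k * N ^ k + k.

Definition polylog_bound (k N : nat) : nat := k * trunc_log 2 N ^ k + k.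

(* The program and the bounds are the same for all inputs (uniformity). *)
Definition NC_solvable (X : Type) (size_of : X -> nat) (enc : X -> seq nat)
    (output : X -> mem -> Prop) : Prop :=
  exists (c : prog) (kp kw kt : nat), forall x : X, exists (t : nat) (s : mem),
    [/\ run (poly_bound kp (size_of x)) (poly_bound kw (size_of x))
          c (load (enc x)) t s,
        t <= polylog_bound kt (size_of x)
      & output x s].

Section Encoding.
Variable I : instance.

Definition lists : seq (seq nat) :=
  [seq [seq nat_of_ord p | p <- pref a] | a <- enum 'I_(napp I)].

Definition instance_size : nat := napp I + npost I + size (flatten lists).

(* The numbers of applicants and of posts, the starting offsets of the lists
   (and the total length), and the concatenated lists. *)
Definition encode_instance : seq nat :=
  [:: napp I, npost I
    & [seq sumn (take i (shape lists)) | i <- iota 0 (napp I).+1]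
      ++ flatten lists].

Definition post_code (q : post I) : nat :=
  match q with
  | inl p => p
  | inr a => npost I + a
  end.

Definition mem_assignment (s : mem) (M : assignment I) : Prop :=
  forall a : 'I_(napp I), s a.+1 = post_code (M a).

(* Cell 0 is the answer flag; cells 1, 2, ... hold the matching. *)
Definition max_popular_output (s : mem) : Prop :=
  (s 0 = 1 /\ exists M : assignment I, max_popular M /\ mem_assignment s M)
  \/ (s 0 = 0 /\ ~ exists M : assignment I, popular M).

End Encoding.

(* Main.v *)
From mathcomp Require Import all_boot zify.
Require Import Defs.

(* Let f(a) be the first post of a, and s(a) the best post on the list of a that
   is nobody's first post.  Every popular matching sends each a to f(a) or s(a),
   and conversely such a matching is popular as soon as it fills all first posts.
   So view a as an edge between f(a) and s(a): a matching is an orientation of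
   this graph with in-degrees at most 1.  It exists iff every component has at
   most one cycle; a component with a cycle is then completely matched, and a
   tree leaves exactly one post free, namely its root.  The size is maximal when
   every tree containing a last resort post is rooted at one.

   Each component gets a leading edge: the least non-bridge if there is one,
   else the least edge with s(a) = l(a), else the least edge.  The root is s of
   the leading edge, and non-bridge leading edges are removed.  If the remaining
   graph consists of bridges, edge a is oriented away from the root, that is,
   towards s(a) iff f(a) remains connected to the root when a is deleted too.
   All this needs only connectivity in the graphs with one edge deleted, which
   polynomially many processors compute for all edges at once by repeated
   squaring of the adjacency relations. *)

Set Implicit Arguments.
Unset Strict Implicit.
Unset Printing Implicit Defensive.

(** * Orientations of a graph *)

Section Orientation.
Variables (A T : finType) (f s : A -> T).

Definition joins (b : A) (x y : T) : bool :=
  ((f b == x) && (s b == y)) || ((s b == x) && (f b == y)).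

Definition adj (D : pred A) : rel T :=
  [rel x y | [exists b, D b && joins b x y]].

Definition conn (D : pred A) : rel T := connect (adj D).

Definition sans (b : A) (D : pred A) : pred A := [pred a | D a && (a != b)].

Definition sel (y : A -> bool) (a : A) : T := if y a then s a else f a.

Lemma joinsC b x y : joins b x y = joins b y x.
Proof. by rewrite /joins orbC andbC [(f b == x) && _]andbC. Qed.

Lemma conn_sym D : symmetric (conn D).
Proof.
apply: sym_connect_sym => x y; rewrite /adj /=.
by apply: eq_existsb => b; rewrite joinsC.
Qed.

Lemma conn_refl D x : conn D x x.
Proof. exact: connect0. Qed.

Lemma conn_trans D : transitive (conn D).
Proof. exact: connect_trans. Qed.

Lemma conn_joins (D : pred A) b x y : D b -> joins b x y -> conn D x y.
Proof.
by move=> Db bxy; apply: connect1; apply/existsP; exists b; rewrite Db.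
Qed.

Lemma conn_edge (D : pred A) b : D b -> conn D (f b) (s b).
Proof. by move=> /conn_joins; apply; rewrite /joins !eqxx. Qed.

Lemma conn_ind (D : pred A) x (Q : T -> Prop) :
  Q x ->
  (forall b z w, D b -> joins b z w -> conn D x z -> Q z -> Q w) ->
  forall y, conn D x y -> Q y.
Proof.
move=> Qx step y /connectP [p]; elim/last_ind: p y => [|p z IHp] y /=.
  by move=> _ ->.
rewrite rcons_path last_rcons => /andP [xp /existsP [b /andP [Db bz]]] ->.
apply: step Db bz _ _; first by apply/connectP; exists p.
exact: IHp.
Qed.

(** Only edges in the component of [x] need a replacement. This lets a detour depend on facts that
    hold within one component. *)
Lemma conn_sub (D D' : pred A) x y :
  (forall b, D b -> conn D x (f b) -> conn D' (f b) (s b)) ->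
  conn D x y -> conn D' x y.
Proof.
move=> DD' xy; apply: (conn_ind (Q := conn D' x) _ _ xy) => [|b z w Db bzw xz].
  exact: conn_refl.
move=> /conn_trans; apply.
have xw : conn D x w by apply: conn_trans xz (conn_joins Db bzw).
case/orP: bzw => /andP [/eqP bz /eqP bw]; subst z w; first exact: DD'.
by rewrite conn_sym; apply: DD'.
Qed.

Lemma conn_mono (D D' : pred A) x y : subpred D D' -> conn D x y -> conn D' x y.
Proof. by move=> DD'; apply: conn_sub => b /DD' /conn_edge. Qed.


Lemma joins_sel y b z w : joins b z w ->
  (z = sel y b /\ w = sel (predC y) b) \/ (z = sel (predC y) b /\ w = sel y b).
Proof.
rewrite /sel /=; case: (y b) => /orP [] /andP [/eqP <- /eqP <-] /=; auto.
Qed.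

Inductive reached (D : pred A) y (u : T) : T -> Prop :=
  | reached_root : reached D y u u
  | reached_edge b :
      D b -> reached D y u (sel (predC y) b) -> reached D y u (sel y b).

(* All edges on a path leaving an unmatched vertex are oriented away from it. *)
Lemma unmatched_unique (D : pred A) y u v :
  (forall a b, D a -> D b -> sel y a = sel y b -> a = b) ->
  (forall a, D a -> sel y a != u) -> (forall a, D a -> sel y a != v) ->
  conn D u v -> u = v.
Proof.
move=> inj Du Dv uv.
have : reached D y u v.
  apply: (conn_ind (Q := reached D y u) _ _ uv) => [|b z w Db bzw _ gz]; first exact: reached_root.
  case: (joins_sel y bzw) => [] [zE wE]; subst z w; last exact: reached_edge.
  (* Here [b] points back at [z]. As [z] has in-degree at most 1, the edge that entered it is [b]
     itself, so [w] was already reached. *)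
  move: gz; move E : (sel y b) => z gz.
  case: gz E => [/eqP|a Da ga ab]; first by rewrite (negbTE (Du _ Db)).
  by rewrite (inj _ _ Db Da ab).
by move=> uv'; case: uv' Dv => // a Da _ /(_ a Da); rewrite eqxx.
Qed.

(** [lr] marks the edges with s(a) = l(a), [nb] the non-bridges, and [lead] the leading edge of the
    component. The hypotheses below isolate what the orientation argument needs from the way leaders
    are chosen. *)
Variables (lr nb : pred A) (lead : A -> A).

Hypothesis fNs : forall a b, f a != s b.
Hypothesis lr_inj : forall a b, lr a -> s b = s a -> b = a.
Hypothesis nbE : forall b, nb b = conn (predC1 b) (f b) (s b).
Hypothesis lead_conn : forall a, conn predT (f (lead a)) (f a).
Hypothesis lead_eq :
  forall a b, conn predT (f a) (f b) -> lead a = lead b.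
Hypothesis lead_nb :
  forall a b, nb b -> conn predT (f b) (f a) -> nb (lead a).
Hypothesis lead_lr :
  forall a b, lr b -> conn predT (f b) (f a) -> nb (lead a) || lr (lead a).

Definition alive : pred A := [pred b | ~~ (nb b && (lead b == b))].

Definition orientable : Prop :=
  forall b, alive b -> ~~ conn (sans b alive) (f b) (s b).

Definition orient (a : A) : bool := conn (sans a alive) (s (lead a)) (f a).

Lemma lead_lead a : lead (lead a) = lead a.
Proof. exact: lead_eq. Qed.

Lemma conn_fs a : conn predT (f a) (s a).
Proof. exact: conn_edge. Qed.

Lemma conn_sf a : conn predT (s a) (f a).
Proof. by rewrite conn_sym conn_fs. Qed.

Lemma conn_sel y a : conn predT (f a) (sel y a).
Proof. by rewrite /sel; case: ifP => _; [exact: conn_fs | exact: conn_refl]. Qed.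

Lemma lead_sel y z a b : conn predT (sel y a) (sel z b) -> lead a = lead b.
Proof.
move=> ab; apply: lead_eq; apply: conn_trans (conn_sel y a) _.
by apply: conn_trans ab _; rewrite conn_sym conn_sel.
Qed.

Lemma conn_without b x y : nb b -> conn predT x y -> conn (predC1 b) x y.
Proof.
rewrite nbE => nbb; apply: conn_sub => a _ _.
by case: (eqVneq a b) => [-> // | ab]; apply: conn_edge.
Qed.

(** A dead edge is a non-bridge, so its ends are joined by a detour. The detour stays in the
    component, whose other edges differ from their leader and hence are alive. *)
Lemma conn_alive x y : conn predT x y -> conn alive x y.
Proof.
apply: conn_sub => b _ _.
case: (boolP (alive b)) => [/conn_edge //|]; rewrite negbK => /andP [nbb /eqP bb].
move: (nbb); rewrite nbE; apply: conn_sub => a /= ab bfa.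
apply: conn_edge; rewrite /alive /= -bb -(lead_eq (conn_mono _ bfa)) // in ab *.
by rewrite eq_sym (negbTE ab) andbF.
Qed.

(** A dead edge is its own leader, so [s a] is the root, and living edges still connect it to [f a].
    Thus the dead edge is the one that fills the root. *)
Lemma sel_orient_dead a : ~~ alive a -> sel orient a = s a.
Proof.
rewrite negbK => /andP [nba /eqP aa]; rewrite /sel ifT // /orient aa.
apply: conn_mono (conn_alive (conn_sf a)) => b alb; apply/andP; split=> //.
by apply: contraTneq alb => ->; rewrite negbK nba aa eqxx.
Qed.

(** Deleting a living edge separates its ends, so at most one of them stays with the root, and
    [orient] selects an end that is cut off. *)
Lemma orient_avoids_root a :
  orientable -> alive a -> ~~ conn (sans a alive) (s (lead a)) (sel orient a).
Proof.
move=> ok ala; rewrite /sel; case: ifPn => // fa.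
apply: contra (ok _ ala) => /(conn_trans _); apply; rewrite conn_sym; exact: fa.
Qed.

Lemma orient_neq_root a b :
  orientable -> alive a -> sel orient a != s (lead b).
Proof.
move=> ok ala; apply: contraL (orient_avoids_root ok ala) => /eqP ab.
have -> : lead a = lead b.
  by rewrite -[RHS]lead_lead; apply: (@lead_sel orient xpredT); rewrite ab conn_refl.
by rewrite ab conn_refl.
Qed.

(** A path from [r] is cut at its first visit to [q]. The disjunction
    [(q' != q /\ conn D' r q') \/ goal] is carried along the path, and its first half is absurd at
    the end. *)
Lemma conn_last (D : pred A) r q : conn D r q -> r != q ->
  exists b z, [/\ D b, joins b z q &
    conn [pred a | D a && ((f a != q) && (s a != q))] r z].
Proof.
move=> rq rNq; set D' := [pred a | _].
pose goal := exists b z, [/\ D b, joins b z q & conn D' r z].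
suff [[]|//] : (q != q /\ conn D' r q) \/ goal by rewrite eqxx.
apply: (conn_ind (Q := fun q' => (q' != q /\ conn D' r q') \/ goal) _ _ rq) => [|b z w Db bzw _].
  by left; rewrite conn_refl.
case=> [[zq rz]|]; last by right.
case: (eqVneq w q) => [wq|wq]; first by right; exists b, z; rewrite -wq.
left; split=> //; apply: conn_trans rz _; apply: conn_joins (bzw).
by rewrite /D' /= Db; case/orP: bzw => /andP [/eqP -> /eqP ->]; rewrite zq wq.
Qed.

(** If two living edges shared their head, a path from the root would enter that head first through
    some edge [c]. One of the two differs from [c], and deleting it leaves the head connected to the
    root. Dead edges point to the root, which living edges avoid, and a component has at most one
    dead edge. *)
Lemma sel_orient_inj : orientable -> injective (sel orient).
Proof.
move=> ok a b ab.
have lab : lead a = lead b by apply: (@lead_sel orient orient); rewrite ab conn_refl.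
have root c : ~~ alive c -> sel orient c = s (lead c).
  by move=> dc; rewrite sel_orient_dead //; move: dc; rewrite negbK => /andP [_ /eqP ->].
case: (boolP (alive a)) => [ala|da]; case: (boolP (alive b)) => [alb|db].
- apply/eqP; apply/negPn/negP => aNb.
  have rNq : s (lead a) != sel orient a by rewrite eq_sym orient_neq_root.
  have /conn_last/(_ rNq) : conn alive (s (lead a)) (sel orient a).
    apply: conn_alive; apply: conn_trans (conn_sel _ _).
    exact: conn_trans (conn_sf _) (lead_conn _).
  move=> [c [z [alc cz rz]]].
  have reach d : sel orient d = sel orient a -> c != d ->
      conn (sans d alive) (s (lead a)) (sel orient a).
    move=> da cd; apply: (@conn_trans _ z); last first.
      by apply: conn_joins cz; rewrite /sans /= alc.
    apply: conn_mono rz => e /andP [ale /andP [fe se]]; apply/andP; split=> //.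
    by apply: contraTneq fe => ed; subst e; move: se; rewrite -da /sel;
       case: ifP => _; rewrite eqxx.
  case: (eqVneq c a) => [ca|ca].
    have := orient_avoids_root ok alb; rewrite -lab -ab reach // ca //.
  by have := orient_avoids_root ok ala; rewrite reach.
- by have := orient_neq_root b ok ala; rewrite ab root // eqxx.
- by have := orient_neq_root a ok alb; rewrite -ab root // eqxx.
- move: da db; rewrite !negbK => /andP [_ /eqP la] /andP [_ /eqP lb].
  by rewrite -la -lb.
Qed.

(** Living edges never fill the root. A free [f a] would be a second free vertex of the component,
    hence equal to the root, but the root is an [s]-end. *)
Lemma orient_f_matched a : orientable -> exists b, sel orient b = f a.
Proof.
move=> ok; apply/exists_eqP; apply: contraT => /existsPn un.
have : f a = s (lead a); last by move/eqP; rewrite (negbTE (fNs _ _)).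
apply: (@unmatched_unique alive orient) => [? ? _ _ /(sel_orient_inj ok) //|b _|b alb|].
- exact: un.
- exact: orient_neq_root.
apply: conn_alive; apply: conn_trans (conn_fs _).
by rewrite conn_sym lead_conn.
Qed.

(** A living non-bridge [b] means a second cycle besides the one of the dead leader. With both edges
    deleted, their two heads are free yet still connected, so they coincide and [b] would be the
    leader. *)
Lemma orientable_of_inj y : injective (sel y) -> orientable.
Proof.
move=> inj b alb; apply/negP => bb.
have nbb : nb b by rewrite nbE; apply: conn_mono bb => a /andP [].
have ne : nb (lead b) by apply: lead_nb nbb (conn_refl _ _).
have de : ~~ alive (lead b) by rewrite negbK ne lead_lead eqxx.
have eb : lead b = b; last by rewrite eb alb in de.
apply: (inj); apply: (@unmatched_unique (sans b alive) y) => [? ? _ _ /inj //|a|a|].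
- by case/andP=> ala _; apply: contraTneq ala => /inj ->.
- by case/andP=> _; apply: contra => /eqP /inj ->.
have : conn predT (sel y (lead b)) (sel y b).
  apply: (conn_trans _ (conn_sel _ _)); apply: (conn_trans _ (lead_conn _)).
  by rewrite conn_sym conn_sel.
move=> /conn_alive; apply: conn_sub => a ala _.
by case: (eqVneq a b) => [-> // | ab]; apply: conn_edge; rewrite /sans /= ala.
Qed.

Lemma orient_max y : injective (sel y) ->
  #|[set a | lr a && ~~ y a]| <= #|[set a | lr a && ~~ orient a]|.
Proof.
move=> inj.
have un a : lr a && ~~ y a -> forall b, sel y b != s a.
  case/andP=> lra ya b; apply/eqP; rewrite /sel; case: ifP => [yb /(lr_inj lra) ba|_ /eqP].
    by rewrite -ba yb in ya.
  by rewrite (negbTE (fNs _ _)).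
have nnb a : lr a && ~~ y a -> ~~ nb (lead a).
  move=> ha; apply/negP => ne.
  have /eqP : sel y (lead a) = s a; last by rewrite (negbTE (un _ ha _)).
  apply: (@unmatched_unique (predC1 (lead a)) y) => [? ? _ _ /inj //|b|b _|].
  - by apply: contra => /eqP /inj ->.
  - exact: un.
  apply: conn_without ne _; apply: conn_trans (conn_fs _).
  by apply: conn_trans (lead_conn _); rewrite conn_sym conn_sel.
have li : {in [set a | lr a && ~~ y a] &, injective lead}.
  move=> a b; rewrite !inE => ha hb ab.
  have /andP [lra _] := hb; apply: (lr_inj lra).
  apply: (@unmatched_unique predT y) => [? ? _ _ /inj //|c _|c _|]; try exact: un.
  apply: conn_trans (conn_fs b); apply: conn_trans (lead_conn b).
  by rewrite -ab; apply: conn_trans (conn_sf a) _; rewrite conn_sym lead_conn.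
rewrite -(card_in_imset li); apply: subset_leq_card; apply/subsetP => _ /imsetP [a + ->].
rewrite !inE => ha; have /andP [lra _] := ha.
have := lead_lr lra (conn_refl _ _); rewrite (negbTE (nnb _ ha)) /= => -> /=.
apply: contra (nnb _ ha); rewrite /orient lead_lead nbE conn_sym.
by apply: conn_mono => b /andP [].
Qed.

End Orientation.

(** * Popular matchings *)

Section Characterization.
Variable I : instance.
Implicit Types (a b c : 'I_(napp I)) (p q : post I) (M : assignment I).

Definition fpost a : post I := head (last_resort a) (plist a).

Definition is_fpost p : bool := [exists a, fpost a == p].

Definition spost a : post I :=
  nth (last_resort a) (plist a) (find (predC is_fpost) (plist a)).

Definition spost_last a : bool := spost a == last_resort a.

Lemma fpost_is_fpost a : is_fpost (fpost a).
Proof. by apply/existsP; exists a. Qed.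

Lemma plist_uniq a : uniq (plist a).
Proof.
rewrite /plist rcons_uniq map_inj_uniq ?pref_uniq ?andbT; last by move=> ? ? [].
by apply/mapP => [[]].
Qed.

Lemma fpostE a (x0 : 'I_(npost I)) : fpost a = inl (head x0 (pref a)).
Proof. by rewrite /fpost /plist; case: (pref a) (pref_nonempty a). Qed.

Lemma mem_fpost a : fpost a \in plist a.
Proof. by rewrite /fpost /plist headI /= inE eqxx. Qed.

Lemma index_fpost a : index (fpost a) (plist a) = 0.
Proof. by rewrite /fpost /plist headI /= eqxx. Qed.

Lemma mem_last_resort a : last_resort a \in plist a.
Proof. by rewrite /plist mem_rcons inE eqxx. Qed.

Lemma mem_plist_last a b : (last_resort b \in plist a) = (b == a).
Proof.
rewrite /plist mem_rcons inE /last_resort; apply/orP/eqP => [[/eqP [] //|]|->].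
  by case/mapP.
by left.
Qed.

Lemma fpost_neq_last a b : fpost a != last_resort b.
Proof.
by have := pref_nonempty a; case E : (pref a) => [//|x0 ?] _; rewrite (fpostE _ x0).
Qed.

Lemma last_resort_nf a : ~~ is_fpost (last_resort a).
Proof. by apply/existsPn => b; apply: fpost_neq_last. Qed.

Lemma has_nf a : has (predC is_fpost) (plist a).
Proof. by apply/hasP; exists (last_resort a); rewrite ?mem_last_resort //= last_resort_nf. Qed.

Lemma spost_nf a : ~~ is_fpost (spost a).
Proof. exact: (nth_find _ (has_nf a)). Qed.

Lemma mem_spost a : spost a \in plist a.
Proof. by rewrite mem_nth // -has_find has_nf. Qed.

Lemma index_spost a : index (spost a) (plist a) = find (predC is_fpost) (plist a).
Proof. by rewrite index_uniq ?plist_uniq // -has_find has_nf. Qed.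

Lemma fpost_neq_spost a b : fpost a != spost b.
Proof. by apply: contraNneq (spost_nf b) => <-; apply: fpost_is_fpost. Qed.

Lemma spost_last_inj a b : spost_last a -> spost b = spost a -> b = a.
Proof.
move=> /eqP -> sb; apply/eqP; rewrite eq_sym -mem_plist_last -sb; exact: mem_spost.
Qed.

Lemma prefers_mem a p q : prefers a p q -> p \in plist a.
Proof. by move=> /leq_trans/(_ (index_size _ _)); rewrite index_mem. Qed.

Lemma prefers_fpost a p : p \in plist a -> p != fpost a -> prefers a (fpost a) p.
Proof.
move=> pa pf; rewrite /prefers index_fpost lt0n.
apply: contraNneq pf; rewrite -(index_fpost a).
by move=> /index_inj e; rewrite e ?mem_fpost.
Qed.

Lemma prefers_spost_is_fpost a p : prefers a p (spost a) -> is_fpost p.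
Proof.
move=> h; have pa := prefers_mem h; move: h.
rewrite /prefers index_spost => /(before_find (last_resort a)) /=.
by rewrite nth_index // => /negbFE.
Qed.

(* Otherwise [a1] takes [p], its holder takes its own first choice, and at most
   one applicant, sent to its last resort, is worse off. *)
Lemma popular_preferred M a1 p :
  popular M -> prefers a1 p (M a1) -> exists2 a2, M a2 = p & fpost a2 = p.
Proof.
case=> [[injM memM] popM] a1p.
have pa1 := prefers_mem a1p.
have prefersxx a q : prefers a q q = false by rewrite /prefers ltnn.
have pNM : p != M a1 by apply: contraTneq a1p => ->; rewrite prefersxx.
case: (pickP (fun a => M a == p)) => [a2 /eqP a2p | noa]; last first.
  (* If [p] is free, moving [a1] there improves [a1] and affects nobody else. *)
  pose M' : assignment I := [ffun a => if a == a1 then p else M a].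
  case: (popM M').
    split=> [a b|a]; rewrite !ffunE; last by case: eqP => [->|].
    case: eqP => [->|_]; case: eqP => [-> //|_]; last exact: injM.
      by move/eqP; rewrite eq_sym noa.
    by move/eqP; rewrite noa.
  rewrite /more_popular; have -> : preferring M M' = set0.
    apply/setP => a; rewrite !inE ffunE; case: eqP => [->|_]; rewrite ?prefersxx //.
    by rewrite /prefers ltnNge (ltnW a1p).
  rewrite cards0 card_gt0; apply/set0Pn; exists a1.
  by rewrite inE ffunE eqxx.
exists a2 => //; apply/eqP; apply: contraT => fa2p.
have a12 : a2 != a1 by apply: contraNneq pNM => <-; rewrite a2p.
pose M' : assignment I := [ffun a => if a == a1 then p else
  if a == a2 then fpost a2 else if M a == fpost a2 then last_resort a else M a].
have injP a : (p == M a) = (a == a2).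
  by rewrite -a2p (inj_eq injM) eq_sym.
have pl a : a != a1 -> p != last_resort a.
  by move=> aa1; apply: contraTneq pa1 => ->; rewrite mem_plist_last.
case: (popM M').
  split=> [|a]; last first.
    rewrite !ffunE; case: eqP => [->|_] //; case: eqP => [->|_]; first exact: mem_fpost.
    by case: eqP; rewrite ?mem_last_resort.
  (* [R] is [M'] away from [a1] and [a2]. It is injective and never takes the posts [p] and
     [fpost a2] given to these two. *)
  pose R a := if M a == fpost a2 then last_resort a else M a.
  have RNp a : a != a1 -> a != a2 -> R a != p.
    by move=> aa1 aa2; rewrite /R; case: ifP => _; rewrite eq_sym ?pl // injP.
  have RNf a : R a != fpost a2.
    by rewrite /R; case: ifPn => // _; rewrite eq_sym fpost_neq_last.
  have Rinj : injective R.
    have aux a b : M a = last_resort b -> a = b.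
      by move=> ab; apply/eqP; rewrite eq_sym -mem_plist_last -ab.
    move=> a b; rewrite /R; case: ifP => _; case: ifP => _; last exact: injM.
    - by case.
    - by move/esym/aux.
    - exact: aux.
  move=> a b; rewrite !ffunE -/(R a) -/(R b).
  case: (eqVneq a a1) => [->|aa1]; case: (eqVneq b a1) => [-> //|ba1].
  - case: (eqVneq b a2) => [-> /eqP|ba2 /eqP]; first by rewrite eq_sym (negbTE fa2p).
    by rewrite eq_sym (negbTE (RNp _ _ _)).
  - case: (eqVneq a a2) => [-> /eqP|aa2 /eqP]; first by rewrite (negbTE fa2p).
    by rewrite (negbTE (RNp _ _ _)).
  case: (eqVneq a a2) => [->|aa2]; case: (eqVneq b a2) => [-> //|ba2].
  - by move/eqP; rewrite eq_sym (negbTE (RNf _)).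
  - by move/eqP; rewrite (negbTE (RNf _)).
  exact: Rinj.
have up : [set a1; a2] \subset preferring M' M.
  apply/subsetP => a; rewrite !inE ffunE => /orP [] /eqP ->; first by rewrite eqxx.
  rewrite (negbTE a12) eqxx; apply: prefers_fpost => //.
  by rewrite a2p eq_sym.
have down : #|preferring M M'| <= 1.
  apply/card_le1_eqP => a b.
  have fM c : c \in preferring M M' -> M c = fpost a2.
    rewrite inE ffunE; case: eqP => [->|_]; first by rewrite /prefers ltnNge (ltnW a1p).
    case: eqP => [->|_]; first by rewrite /prefers index_fpost.
    by case: eqP => //; rewrite prefersxx.
  by move=> /fM fa /fM fb; apply: injM; rewrite fa.
rewrite /more_popular; apply: leq_trans (subset_leq_card up).
by rewrite cards2 eq_sym a12.
Qed.

(** A post better than s(a) is the first post of some [b]. If [a] is not itself such a [b], then [b]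
    prefers it to its own post, so by [popular_preferred] its holder [a] has it as first post. If
    M(a) is worse than s(a), the same lemma makes s(a) a first post. *)
Lemma popular_sel M : popular M -> forall a, M a = sel fpost spost (fun a => M a == spost a) a.
Proof.
move=> popM a; rewrite /sel; case: eqP => // /eqP Ms.
have [[injM memM] _] := popM.
apply/eqP; apply: contraT => Mf.
have sa := mem_spost a.
case: (ltngtP (index (M a) (plist a)) (index (spost a) (plist a))) => [lt|lt|eqi].
- have /existsP [b /eqP fb] := prefers_spost_is_fpost lt.
  have bM : prefers b (M a) (M b).
    rewrite -fb; apply: prefers_fpost => //; rewrite fb (inj_eq injM).
    by apply: contraNneq Mf => ba; rewrite -fb ba.
  have [c /injM -> fa] := popular_preferred popM bM.
  by rewrite fa eqxx in Mf.
- have [c _ fc] := popular_preferred popM lt.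
  by have := fpost_neq_spost c a; rewrite fc eqxx.
- by rewrite (index_inj (spost a) (memM a) sa eqi) eqxx in Ms.
Qed.

(** Whoever gains under a rival matching gains a first post. The applicant who held that post in [M]
    had it as its own first choice and loses, so gainers inject into losers. *)
Lemma sel_popular (y : 'I_(napp I) -> bool) :
  injective (sel fpost spost y) ->
  (forall a, exists b, sel fpost spost y b = fpost a) ->
  popular [ffun a => sel fpost spost y a].
Proof.
set M := [ffun a => _] => inj fM; split.
  split=> [a b|a]; rewrite !ffunE; first exact: inj.
  by rewrite /sel; case: ifP => _; [exact: mem_spost | exact: mem_fpost].
move=> M' [inj' mem'] /=; apply/negP; rewrite -leqNgt.
have fP a : exists b, (a \in preferring M' M) ==> ((M' a == fpost b) && (M b == fpost b)).
  case: (boolP (a \in _)) => [|_]; last by exists a.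
  rewrite inE ffunE /sel; case: ifP => _; last by rewrite /prefers index_fpost.
  move/prefers_spost_is_fpost => /existsP [c /eqP <-].
  have [b bc] := fM c; exists b; rewrite ffunE bc /=.
  move: bc; rewrite /sel; case: ifP => _ bc; last by rewrite bc eqxx.
  by have := fpost_neq_spost c b; rewrite bc eqxx.
pose g a := xchoose (fP a).
have gP a : a \in preferring M' M -> M' a = fpost (g a) /\ M (g a) = fpost (g a).
  by move=> ha; have := xchooseP (fP a); rewrite -/(g a) ha => /andP [/eqP -> /eqP ->].
have gi : {in preferring M' M &, injective g}.
  by move=> a b ha hb ab; apply: inj'; rewrite (gP a ha).1 (gP b hb).1 ab.
rewrite -(card_in_imset gi); apply: subset_leq_card; apply/subsetP => _ /imsetP [a ha ->].
have [Ma Mg] := gP a ha.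
rewrite inE Mg; apply: prefers_fpost => //; rewrite -Ma (inj_eq inj').
apply: contraTneq ha => ga; rewrite inE Ma.
by move: Mg; rewrite ga => ->; rewrite /prefers ltnn.
Qed.

(** The second summand does not depend on [M], so comparing sizes reduces to [orient_max]. *)
Lemma matching_size_sel (y : 'I_(napp I) -> bool) M :
  (forall a, M a = sel fpost spost y a) ->
  matching_size M =
    #|[set a | spost_last a && ~~ y a]| + #|[set a | ~~ spost_last a]|.
Proof.
move=> My; rewrite /matching_size -(cardsID [set a | spost_last a]).
congr (_ + _); apply: eq_card => a; rewrite !inE My /sel.
  case: (y a); rewrite ?andbT ?andbF ?(fpost_neq_last) //.
  by rewrite /spost_last; case: eqP.
case: (boolP (spost_last a)) => //= sl.
by case: (y a); rewrite ?fpost_neq_last.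
Qed.

End Characterization.

(** * Programs over arrays *)

(** The arrays are interleaved in the memory beyond the input. [Scratch] keeps the path length of
    the closure in cell 0 and the answer flag in cell 1. *)
Inductive arr : Type :=
  Reach | First | Second | IsFirst | Alive | Leader | Scratch.

Definition arr_code (j : arr) : nat :=
  match j with
  | Reach => 0 | First => 1 | Second => 2 | IsFirst => 3
  | Alive => 4 | Leader => 5 | Scratch => 6
  end.

Lemma arr_code_inj : injective arr_code.
Proof. by case; case. Qed.

Definition arrays := arr -> nat -> nat.

Definition set_arr (h : arrays) (j : arr) (u : nat -> nat) : arrays :=
  fun j' => if arr_code j' == arr_code j then u else h j'.

(** In guards, products serve as conjunctions and positive sums as disjunctions. *)
Inductive aexp : Type :=
  | ANum of nat
  | APid
  | AIn of aexp
  | ABase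
  | AArr of arr & aexp
  | ABin of binop & aexp & aexp.

Declare Scope aexp_scope.
Delimit Scope aexp_scope with A.
Bind Scope aexp_scope with aexp.
Coercion ANum : nat >-> aexp.
Notation "x + y" := (ABin OAdd x y) : aexp_scope.
Notation "x - y" := (ABin OSub x y) : aexp_scope.
Notation "x * y" := (ABin OMul x y) : aexp_scope.
Notation "x %/ y" := (ABin ODiv x y) : aexp_scope.
Notation "x %% y" := (ABin OMod x y) : aexp_scope.
Notation "x < y" := (ABin OLt x y) : aexp_scope.
Notation "x == y" := (ABin OEq x y) : aexp_scope.
Notation "x <= y" := (ABin OLt x (ABin OAdd y (ANum 1))) : aexp_scope.
Notation "x != y" := (ABin OEq (ABin OEq x y) (ANum 0)) : aexp_scope.
Notation "x || y" := (ABin OLt (ANum 0) (ABin OAdd x y)) : aexp_scope.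
Notation "j .[ e ]" := (AArr j e) : aexp_scope.

(** Cell [2 + n] holds the total length of the lists, so this is the instance size plus 3. It is
    both the first address past the input and the radix in which processor indices are split. *)
Definition base_expr : expr :=
  Bin OAdd (Const 3) (Bin OAdd (Bin OAdd (Read (Const 0)) (Read (Const 1)))
    (Read (Bin OAdd (Const 2) (Read (Const 0))))).

Definition addr_expr (j : arr) (e : expr) : expr :=
  Bin OAdd base_expr (Bin OAdd (Bin OMul e (Const 7)) (Const (arr_code j))).

(* [AIn e] is 0 outside the input, where an unguarded read would depend on the
   arrays. *)
Fixpoint comp (e : aexp) : expr :=
  match e with
  | ANum c => Const c
  | APid => Pid
  | AIn e1 => Bin OMul (Bin OLt (comp e1) base_expr) (Read (comp e1))
  | ABase => base_expr
  | AArr j e1 => Read (addr_expr j (comp e1))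
  | ABin o e1 e2 => Bin o (comp e1) (comp e2)
  end.

Definition upd (j : arr) (g i v : aexp) : prog :=
  Par (comp g) (addr_expr j (comp i)) (comp v).

Definition first_write (P : nat) (g : pred nat) (i v u : nat -> nat) : nat -> nat :=
  fun x => if [seq p <- iota 0 P | g p && (i p == x)] is p :: _ then v p else u x.

Variant first_write_spec P (g : pred nat) (i v u : nat -> nat) x : nat -> Prop :=
  | Written p : p < P -> g p -> i p = x ->
      (forall q, q < P -> g q -> i q = x -> p <= q) ->
      first_write_spec P g i v u x (v p)
  | Unwritten : (forall p, p < P -> g p -> i p <> x) ->
      first_write_spec P g i v u x (u x).

Lemma first_writeP P g i v u x :
  first_write_spec P g i v u x (first_write P g i v u x).
Proof.
rewrite /first_write; set r := [seq p <- _ | _].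
have mem_r p : (p \in r) = [&& p < P, g p & i p == x].
  by rewrite mem_filter mem_iota /= add0n andbC.
have : sorted ltn r by apply: sorted_filter (iota_ltn_sorted _ _); exact: ltn_trans.
case: r mem_r => [|p r] mem_r /=.
  move=> _; apply: Unwritten => p pP gp ip.
  by have := mem_r p; rewrite pP gp ip eqxx.
rewrite (path_sortedE ltn_trans) => /andP [/allP pr _].
have := mem_r p; rewrite inE eqxx => /esym /and3P [pP gp /eqP ip].
apply: Written => // q qP gq iq.
have := mem_r q; rewrite qP gq iq eqxx inE /= => /orP [/eqP -> //|/pr].
exact: ltnW.
Qed.

Lemma first_write_eq P (g : pred nat) i v u x y p :
  p < P -> g p -> i p = x ->
  (forall q, g q -> i q = x -> v q = y) -> first_write P g i v u x = y.
Proof.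
move=> pP gp ip vy; case: first_writeP => [q _ gq iq _|/(_ p pP gp) //].
exact: vy.
Qed.

Lemma first_write_neq P (g : pred nat) i v u x :
  (forall q, g q -> i q <> x) -> first_write P g i v u x = u x.
Proof. by move=> un; case: first_writeP => // q _ /un. Qed.

(** * Memory layout and a program logic with time bounds *)

Section Machine.
Variables (P W : nat) (inp : nat -> nat).

Definition base : nat := 3 + (inp 0 + inp 1 + inp (2 + inp 0)).

Fixpoint aeval (h : arrays) (p : nat) (e : aexp) : nat :=
  match e with
  | ANum c => c
  | APid => p
  | AIn e1 => let x := aeval h p e1 in if x < base then inp x else 0
  | ABase => base
  | AArr j e1 => h j (aeval h p e1)
  | ABin o e1 e2 => eval_op o (aeval h p e1) (aeval h p e2)
  end.

(* Array [j] occupies the addresses [base + 7 * i + arr_code j]. *)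
Definition rep (h : arrays) (s : mem) : Prop :=
  [/\ forall x, x < base -> s x = inp x,
      forall j i, s (base + (i * 7 + arr_code j)) = h j i
    & forall x, s x <= W].

Lemma eval_base h s p : rep h s -> eval s p base_expr = base.
Proof.
by case=> inpE _ _ /=; rewrite !inpE // /base ?ltnS -?addnA ?leq_addr.
Qed.

Lemma eval_comp h s p e : rep h s -> eval s p (comp e) = aeval h p e.
Proof.
move=> hs; have hb := eval_base p hs; have [inpE arrE _] := hs.
elim: e => [c||e IHe||j e IHe|o e1 IH1 e2 IH2] //=; last by rewrite IH1 IH2.
- rewrite -[X in _ < X]/(eval s p base_expr) hb IHe; case: ltnP => [xb|_].
    by rewrite mul1n inpE.
  by rewrite mul0n.
- by rewrite -[X in X + _]/(eval s p base_expr) hb IHe.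
Qed.

Lemma eval_addr h s p j e : rep h s ->
  eval s p (addr_expr j (comp e)) = base + (aeval h p e * 7 + arr_code j).
Proof.
move=> hs; rewrite /addr_expr -(eval_comp p e hs) -(eval_base p hs); done.
Qed.

Lemma addr_inj i j i' j' :
  base + (i * 7 + arr_code j) = base + (i' * 7 + arr_code j') -> i = i' /\ j = j'.
Proof.
have lt7 k : arr_code k < 7 by case: k.
move/addnI => e.
have ei : i = i'.
  have := congr1 (divn^~ 7) e.
  by rewrite !divnMDl // !divn_small ?lt7 // !addn0.
by split=> //; move: e; rewrite ei => /addnI /arr_code_inj.
Qed.

(** Total correctness with time and word bounds; conditions speak of arrays only, so addresses are
    dealt with once, in [wp_upd]. *)
Definition wp (c : prog) (t : nat) (h : arrays) (Q : arrays -> Prop) : Prop :=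
  forall s, rep h s -> exists t' s' h',
    [/\ run P W c s t' s', t' <= t, rep h' s' & Q h'].

Lemma wp_seq c1 c2 t1 t2 h Q :
  wp c1 t1 h (fun h' => wp c2 t2 h' Q) -> wp (Seq c1 c2) (t1 + t2) h Q.
Proof.
move=> w1 s /w1 [t1' [s1 [h1 [r1 le1 hs1 /(_ _ hs1)]]]] [t2' [s2 [h2 [r2 le2 hs2 q]]]].
exists (t1' + t2'), s2, h2; split=> //; last exact: leq_add.
exact: run_seq r1 r2.
Qed.

Lemma wp_mono c t t' h (Q Q' : arrays -> Prop) :
  t <= t' -> (forall h', Q h' -> Q' h') -> wp c t h Q -> wp c t' h Q'.
Proof.
move=> tt' QQ' w s /w [u [s' [h' [r ut hs q]]]].
by exists u, s', h'; split=> //; [exact: leq_trans tt' | exact: QQ'].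
Qed.

Lemma wp_upd j g i v h (Q : arrays -> Prop) :
  (forall p, aeval h p g != 0 -> aeval h p v <= W) ->
  (forall h', h' j =1 first_write P (fun p => aeval h p g != 0)
                 (fun p => aeval h p i) (fun p => aeval h p v) (h j) ->
     (forall j', arr_code j' != arr_code j -> h' j' = h j') -> Q h') ->
  wp (upd j g i v) 1 h Q.
Proof.
move=> vW q s hs; have [inpE arrE sW] := hs.
set u := first_write _ _ _ _ _ in q.
have stepE x : par_step P (comp g) (addr_expr j (comp i)) (comp v) s x =
    first_write P (fun p => aeval h p g != 0)
      (fun p => base + (aeval h p i * 7 + arr_code j)) (fun p => aeval h p v) s x.
  rewrite /par_step /first_write.
  under eq_filter do rewrite (eval_comp _ _ hs) (eval_addr _ _ _ hs).
  by case: filter => // p _; rewrite (eval_comp _ _ hs).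
have stW x : par_step P (comp g) (addr_expr j (comp i)) (comp v) s x <= W.
  by rewrite stepE; case: first_writeP => // p _ gp _ _; exact: vW.
exists 1, (par_step P (comp g) (addr_expr j (comp i)) (comp v) s), (set_arr h j u).
split=> //; first exact: run_par.
  split=> // [x xb|j' i']; rewrite stepE.
    by rewrite first_write_neq ?inpE // => q' _ xq; rewrite -xq ltnNge leq_addr in xb.
  rewrite /set_arr; case: eqP => jj.
    rewrite (arr_code_inj jj) /u /first_write arrE.
    have eqf : (fun p => (aeval h p g != 0) &&
        (base + (aeval h p i * 7 + arr_code j) == base + (i' * 7 + arr_code j))) =1
        (fun p => (aeval h p g != 0) && (aeval h p i == i')).
      by move=> p; rewrite eqn_add2l eqn_add2r eqn_pmul2r.
    by rewrite (eq_filter eqf).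
  rewrite first_write_neq ?arrE // => p _ /addr_inj [_ /(congr1 arr_code) jj'].
  by rewrite jj' in jj.
apply: q => [x|j' jj'].
  by rewrite /set_arr eqxx.
by rewrite /set_arr (negbTE jj').
Qed.

(** The index of [J] counts the rounds still allowed. Each round adds one unit for its test, and the
    final unit is the failing test. *)
Lemma wp_while b c tb h k (J : nat -> arrays -> Prop) :
  J k h -> (forall h, J 0 h -> aeval h 0 b = 0) ->
  (forall i h, J i.+1 h -> aeval h 0 b <> 0 -> wp c tb h (J i)) ->
  wp (While (comp b) c) (k * tb.+1 + 1) h (fun h' => aeval h' 0 b = 0 /\ exists i, J i h').
Proof.
move=> + b0 step; elim: k h => [|k IHk] h Jh s hs.
  exists 1, s, h; split=> //; first by apply: run_while_false; rewrite (eval_comp _ _ hs) b0.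
  by split; [exact: b0 | exists 0].
have [bz|bz] := eqVneq (aeval h 0 b) 0.
  exists 1, s, h; split=> //; last by split=> //; exists k.+1.
  by apply: run_while_false; rewrite (eval_comp _ _ hs).
move/eqP: bz => bz; have [t1 [s1 [h1 [r1 le1 hs1 J1]]]] := step _ _ Jh bz _ hs.
have [t2 [s2 [h2 [r2 le2 hs2 q]]]] := IHk _ J1 _ hs1.
exists (1 + t1 + t2), s2, h2; split=> //.
  by apply: run_while_true r1 r2; rewrite (eval_comp _ _ hs).
by rewrite mulSn -(addnA _ _ 1) leq_add // add1n ltnS.
Qed.

End Machine.

Lemma conn_eq (A T : finType) (f s : A -> T) (D D' : pred A) x y :
  D =1 D' -> conn f s D x y = conn f s D' x y.
Proof.
by move=> DD'; apply/idP/idP; apply: conn_mono => b; rewrite DD'.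
Qed.

(** * Choice of the leading edges *)

Section Leader.
Variables (A T : finType) (f s : A -> T) (lr nb : pred A) (rank : A -> nat) (B : nat).

(* Processors are numbered by triples [(c, b, a)], and the least one for which
   [candidate c b a] holds writes [b] as the leader of [a]: class 0 admits the
   non-bridges only, class 1 the applicants with [s(b) = l(b)], other classes all
   applicants. *)
Definition candidate (c : nat) (b a : A) : bool :=
  [&& conn f s predT (f b) (f a), (c != 0) || nb b & (c != 1) || lr b].

(** Since ranks lie below [B], the key [c * B + rank b] compares class first and rank second, in the
    order of processor indices. *)
Definition leads (lead : A -> A) : Prop :=
  forall a, exists c, candidate c (lead a) a /\
    forall c' b, candidate c' b a -> c * B + rank (lead a) <= c' * B + rank b.

Variable lead : A -> A.
Hypotheses (rank_inj : injective rank) (rank_lt : forall a, rank a < B).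
Hypothesis leadP : leads lead.

Let B_gt0 (a : A) : 0 < B := leq_ltn_trans (leq0n _) (rank_lt a).

Lemma leads_conn a : conn f s predT (f (lead a)) (f a).
Proof. by have [c [/and3P []]] := leadP a. Qed.

(** Candidates depend only on the component, so the least keys agree, and the rank is the residue of
    the key modulo [B]. *)
Lemma leads_eq a b : conn f s predT (f a) (f b) -> lead a = lead b.
Proof.
move=> ab.
have candE c x : candidate c x a = candidate c x b.
  congr (_ && _); apply/idP/idP => xa; first exact: conn_trans xa ab.
  by apply: conn_trans xa _; rewrite conn_sym.
have [c [ca mina]] := leadP a; have [d [db minb]] := leadP b.
have : c * B + rank (lead a) = d * B + rank (lead b).
  by apply/eqP; rewrite eqn_leq mina ?minb // -?candE // candE.
move=> /(congr1 (modn^~ B)); rewrite !modnMDl !modn_small //; exact: rank_inj.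
Qed.

Lemma candidate_class a b c' c :
  candidate c' b a -> (forall d x, candidate d x a ->
    c * B + rank (lead a) <= d * B + rank x) -> c <= c'.
Proof.
move=> cb /(_ _ _ cb) le; rewrite -ltnS -(ltn_pmul2r (B_gt0 a)).
apply: leq_ltn_trans (leq_addr (rank (lead a)) _) _.
by apply: leq_ltn_trans le _; rewrite mulSn addnC ltn_add2r.
Qed.

Lemma leads_nb a b : nb b -> conn f s predT (f b) (f a) -> nb (lead a).
Proof.
move=> nbb ba; have [c [cl minc]] := leadP a.
have : c <= 0 by apply: (candidate_class (b := b) _ minc); rewrite /candidate ba nbb.
by rewrite leqn0 => /eqP c0; move: cl; rewrite c0 => /and3P [].
Qed.

Lemma leads_lr a b : lr b -> conn f s predT (f b) (f a) ->
  nb (lead a) || lr (lead a).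
Proof.
move=> lrb ba; have [c [cl minc]] := leadP a.
have : c <= 1 by apply: (candidate_class (b := b) _ minc); rewrite /candidate ba lrb.
by case: c cl {minc} => [|[|//]] /and3P [_ /= h1 h2] _; rewrite ?h1 ?h2 ?orbT.
Qed.

End Leader.

(** * Transitive closure by repeated squaring *)

Section Squaring.
Variables (T : finType) (e : rel T).

(** This is completeness up to length [d] only; soundness is a separate clause of the loop
    invariant. *)
Definition covers (d : nat) (R : rel T) : Prop :=
  forall x p, path e x p -> size p <= d -> R x (last x p).

Lemma covers_double d (R R' : rel T) :
  (forall x y z, R x y -> R y z -> R' x z) -> covers d R -> covers (d + d) R'.
Proof.
move=> RR' cR x p; rewrite -{1 3}(cat_take_drop d p) cat_path last_cat.
move=> /andP [p1 p2] sp; apply: RR' (cR _ _ p1 _) (cR _ _ p2 _).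
  by rewrite size_take_min geq_minl.
by rewrite size_drop leq_subLR.
Qed.

Lemma covers_connect d (R : rel T) x y :
  #|T| <= d -> covers d R -> connect e x y -> R x y.
Proof.
move=> Td cR /connectP [p /shortenP [q xq uq _] ->]; apply: cR => //.
apply: ltnW; apply: leq_trans Td; rewrite -[(size q).+1]/(size (x :: q)) -(card_uniqP uq).
exact: max_card.
Qed.

End Squaring.

(** * Digits in base [B] *)

Section Digits.
Variable B : nat.

Lemma digit_div x y : y < B -> (x * B + y) %/ B = x.
Proof.
by move=> yB; rewrite divnMDl ?divn_small ?addn0 //; apply: leq_ltn_trans yB.
Qed.

Lemma digit_mod x y : y < B -> (x * B + y) %% B = y.
Proof. by move=> yB; rewrite modnMDl modn_small. Qed.

Lemma digit_inj x y x' y' : y < B -> y' < B ->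
  x * B + y = x' * B + y' -> x = x' /\ y = y'.
Proof.
move=> yB y'B e; split.
  by rewrite -(digit_div x yB) e digit_div.
by rewrite -(digit_mod x yB) e digit_mod.
Qed.

Lemma digit_lt k x y : x < B ^ k -> y < B -> x * B + y < B ^ k.+1.
Proof.
move=> xB yB; rewrite expnSr; apply: (@leq_trans (x.+1 * B)); last by rewrite leq_mul2r xB orbT.
by rewrite mulSn addnC ltn_add2r.
Qed.

End Digits.

(** * Reading the encoded instance *)

Section Input.
Variable I : instance.
Notation n := (napp I).
Notation m := (npost I).
Implicit Type a : 'I_(napp I).

Definition input : nat -> nat := load (encode_instance I).

Definition offset (i : nat) : nat := sumn (take i (shape (lists I))).

Lemma size_lists : size (lists I) = n.
Proof. by rewrite size_map size_enum_ord. Qed.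

Lemma size_shape_lists : size (shape (lists I)) = n.
Proof. by rewrite size_map size_lists. Qed.

Lemma nth_lists a : nth [::] (lists I) a = [seq nat_of_ord p | p <- pref a].
Proof. by rewrite (nth_map a) ?size_enum_ord // nth_ord_enum. Qed.

Lemma nth_shape_lists a : nth 0 (shape (lists I)) a = size (pref a).
Proof. by rewrite (nth_map [::]) ?size_lists // nth_lists size_map. Qed.

Lemma input_napp : input 0 = n. Proof. by []. Qed.

Lemma input_npost : input 1 = m. Proof. by []. Qed.

Lemma inputSS i :
  input i.+2 = nth 0 ([seq offset i | i <- iota 0 n.+1] ++ flatten (lists I)) i.
Proof. by []. Qed.

Lemma input_offset i : i <= n -> input (2 + i) = offset i.
Proof.
move=> le; rewrite -[2 + i]/i.+2 inputSS nth_cat size_map size_iota ltnS le.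
by rewrite (nth_map 0) ?size_iota // nth_iota.
Qed.

(** The shift [3 + n] skips the two counts and the [n + 1] offsets. *)
Lemma input_pref a c x0 : c < size (pref a) ->
  input (3 + n + (offset a + c)) = nth x0 (pref a) c.
Proof.
move=> lt; rewrite -[3 + n + _]/(n.+1 + (offset a + c)).+2 inputSS.
rewrite nth_cat size_map size_iota ltnNge leq_addr /= addKn.
have -> : offset a + c = flatten_index (shape (lists I)) a c by [].
rewrite nth_flatten flatten_indexKl ?flatten_indexKr ?nth_shape_lists //.
by rewrite nth_lists (nth_map x0).
Qed.

Lemma offsetS a : offset a.+1 = offset a + size (pref a).
Proof.
by rewrite /offset (take_nth 0) ?size_shape_lists // sumn_rcons nth_shape_lists.
Qed.

Lemma offset_napp : offset n = size (flatten (lists I)).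
Proof. by rewrite /offset take_oversize ?size_shape_lists // size_flatten. Qed.

Lemma offset_le i : offset i <= size (flatten (lists I)).
Proof.
rewrite size_flatten -[X in _ <= sumn X](cat_take_drop i) sumn_cat.
exact: leq_addr.
Qed.

Lemma base_input : base input = (instance_size I).+3.
Proof.
by rewrite /base input_napp input_npost input_offset // offset_napp.
Qed.

(** The encoding has [3 + n] cells plus the total list length, which is [m] less than [base]. Hence
    the guard in [AIn] is harmless and all arrays start at zero. *)
Lemma input_oversize x : base input <= x -> input x = 0.
Proof.
rewrite base_input => le; rewrite /input /load nth_default //.
apply: leq_trans le.
rewrite -[size _]/(size ([seq offset i | i <- iota 0 n.+1] ++ flatten (lists I))).+2.
by rewrite size_cat size_map size_iota addSn !ltnS leq_add2r leq_addr.
Qed.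

Lemma input_le x : input x <= instance_size I.
Proof.
have N1 : n <= instance_size I by rewrite /instance_size -addnA leq_addr.
have N2 : m <= instance_size I by rewrite /instance_size addnAC leq_addl.
case: x => [//|[//|x]]; case: (leqP x n) => [le|gt].
  rewrite -[x.+2]/(2 + x) input_offset //.
  by apply: leq_trans (offset_le _) (leq_addl _ _).
rewrite inputSS nth_cat size_map size_iota (ltnNge x) gt /=.
set j := x - _; case: (ltnP j (size (flatten (lists I)))) => [lt|]; last first.
  by move/(nth_default 0) ->.
have /flattenP [_ /mapP [a _ ->] /mapP [p _ ->]] := mem_nth 0 lt.
exact: leq_trans (ltnW (ltn_ord p)) N2.
Qed.

Lemma post_code_inj : injective (@post_code I).
Proof.
have lem (p : 'I_m) b : p != m + b :> nat.
  by rewrite neq_ltn (leq_trans (ltn_ord p)) ?leq_addr.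
move=> [p|a] [q|b] //= e.
- by congr inl; apply: val_inj.
- by move/eqP: e; rewrite (negbTE (lem _ _)).
- by move/eqP: e; rewrite eq_sym (negbTE (lem _ _)).
- by congr inr; apply: val_inj; apply: (addnI e).
Qed.

Lemma post_code_lt (q : post I) : post_code q < n + m.
Proof.
case: q => [p|a] /=; last by rewrite addnC ltn_add2r.
exact: leq_trans (ltn_ord p) (leq_addl _ _).
Qed.

(** This justifies the numerical test for s(a) = l(a) in [step_leader]. *)
Lemma post_code_last a (q : post I) : q \in plist a ->
  (m <= post_code q) = (q == last_resort a).
Proof.
case: q => [p|b] /=; first by rewrite leqNgt ltn_ord.
by rewrite leq_addr mem_plist_last => /eqP ->; rewrite eqxx.
Qed.

Lemma spost_nth a c x0 : c < size (pref a) ->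
  ~~ is_fpost (inl (nth x0 (pref a) c) : post I) ->
  (forall c', c' < c -> is_fpost (inl (nth x0 (pref a) c') : post I)) ->
  spost a = inl (nth x0 (pref a) c).
Proof.
move=> cs nc fc.
have nthE i : i < size (pref a) ->
    nth (last_resort a) (plist a) i = inl (nth x0 (pref a) i).
  by move=> lt; rewrite nth_rcons size_map lt (nth_map x0).
rewrite /spost; have -> : find (predC (@is_fpost I)) (plist a) = c; last exact: nthE.
case: (ltngtP (find (predC (@is_fpost I)) (plist a)) c) => // [lt|gt].
  have := nth_find (last_resort a) (has_nf a).
  by rewrite /= nthE ?fc // (ltn_trans lt).
have := before_find (last_resort a) gt.
by rewrite /= nthE // (negbTE nc).
Qed.

Lemma spost_none a x0 :
  (forall c, c < size (pref a) -> is_fpost (inl (nth x0 (pref a) c) : post I)) ->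
  spost a = last_resort a.
Proof.
move=> fc; have := mem_spost a; rewrite {1}/plist mem_rcons inE.
case/orP => [/eqP //|/mapP [p pa sp]].
have := spost_nf a; rewrite sp -(nth_index x0 pa) fc ?index_mem //.
Qed.

End Input.

(** * The program *)

Definition a_napp : aexp := AIn 0.
Definition a_npost : aexp := AIn 1.
Definition a_offset (e : aexp) : aexp := AIn (2 + e).
Definition a_pref (e : aexp) : aexp := AIn (3 + a_napp + e).
Definition a_index (k x y : aexp) : aexp := ((k * ABase + x) * ABase + y)%A.

(* The last, middle and leading parts of the processor index, which stands for
   [(hi * base + mid) * base + lo] or [top * base + lo]. *)
Definition a_lo : aexp := (APid %% ABase)%A.
Definition a_top : aexp := (APid %/ ABase)%A.
Definition a_mid : aexp := (a_top %% ABase)%A.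
Definition a_hi : aexp := (a_top %/ ABase)%A.

Definition step_first : prog :=
  upd First (APid < a_napp) APid (a_pref (a_offset APid)).

Definition step_is_first : prog := upd IsFirst (APid < a_napp) First.[APid] 1.

Definition step_second_last : prog :=
  upd Second (APid < a_napp) APid (a_npost + APid).

(* Write conflicts favour the lowest index, hence the best eligible post. *)
Definition step_second : prog :=
  upd Second ((a_top < a_napp) * (a_offset a_top <= a_lo) *
              (a_lo < a_offset (a_top + 1)) * (IsFirst.[a_pref a_lo] == 0))
    a_top (a_pref a_lo).

Definition step_alive : prog := upd Alive (APid < a_napp) APid 1.

(** Off the diagonal this writes 0, clearing what a previous closure left behind. *)
Definition step_diag : prog := upd Reach 1 APid (a_mid == a_lo).

Definition step_edge (j j' : arr) : prog :=
  upd Reach ((a_lo < a_napp) * Alive.[a_lo] * (a_lo != a_top))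
    (a_index a_top j.[a_lo] j'.[a_lo]) 1.

(** A processor has four digits k, x, y, z, and [a_top] is already the address of (k, x, y). It
    composes x to y with y to z in the graph without edge k. *)
Definition step_square : prog :=
  upd Reach (Reach.[a_top] * Reach.[a_index (a_hi %/ ABase) a_mid a_lo])
    (a_hi * ABase + a_lo) 1.

Definition step_length (e : aexp) : prog := upd Scratch 1 0 e.

Definition closure : prog :=
  Seq step_diag (Seq (step_edge First Second) (Seq (step_edge Second First)
    (Seq (step_length 1)
      (While (comp (Scratch.[0] < ABase))
        (Seq step_square (step_length (Scratch.[0] + Scratch.[0]))))))).

Definition a_joined (k b : aexp) : aexp := Reach.[a_index k First.[b] Second.[b]].

(** No applicant has number n, so slice n of [Reach] describes the whole graph. *)
Definition step_leader : prog :=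
  upd Leader ((a_lo < a_napp) * (a_mid < a_napp) *
              Reach.[a_index a_napp First.[a_mid] First.[a_lo]] *
              ((a_hi != 0) || a_joined a_mid a_mid) *
              ((a_hi != 1) || (a_npost <= Second.[a_mid])))
    a_lo a_mid.

Definition step_kill : prog :=
  upd Alive ((APid < a_napp) * a_joined APid APid * (Leader.[APid] == APid)) APid 0.

Definition step_ok : prog := upd Scratch 1 1 1.

Definition step_check : prog :=
  upd Scratch ((APid < a_napp) * Alive.[APid] * a_joined APid APid) 1 0.

Definition a_orient (a : aexp) : aexp := Reach.[a_index a Second.[Leader.[a]] First.[a]].

Definition a_output : aexp :=
  ((APid == 0) * Scratch.[1] +
   (0 < APid) * ((0 < a_orient (APid - 1)) * Second.[APid - 1] +
                 (a_orient (APid - 1) == 0) * First.[APid - 1]))%A.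

(** The answer overwrites the input, on which [base_expr] depends. A single final instruction is
    safe because all its reads precede its writes. *)
Definition step_output : prog :=
  Par (comp (APid <= a_napp)) (comp APid) (comp a_output).

Definition decide_prog : prog :=
  Seq step_first (Seq step_is_first (Seq step_second_last (Seq step_second
    (Seq step_alive (Seq closure (Seq step_leader (Seq step_kill
      (Seq closure (Seq step_ok step_check))))))))).

Definition popular_prog : prog := Seq decide_prog step_output.

(** * Correctness of the instructions *)

Arguments base : simpl never.
Arguments input : simpl never.

Section Verification.
Variables (I : instance) (P W : nat).
Notation n := (napp I).
Notation m := (npost I).
Notation N := (instance_size I).
Notation B := (instance_size I).+3.
(** [step_square] uses four digits, and the path length is doubled only while below [B]. *)
Hypotheses (BP : B ^ 4 <= P) (BW : B + B <= W).
Implicit Types (h : arrays) (Q : arrays -> Prop) (a b : 'I_(napp I)).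

Notation wp := (wp P W (input I)).
Notation aeval := (aeval (input I)).

Lemma bool_neq0 (b : bool) : ((b : nat) != 0) = b.
Proof. by case: b. Qed.

Lemma mul_neq0 x y : (x * y != 0) = (x != 0) && (y != 0).
Proof. by rewrite muln_eq0 negb_or. Qed.

Lemma add_gt0 x y : (0 < x + y) = (x != 0) || (y != 0).
Proof. by rewrite addn_gt0 !lt0n. Qed.

Lemma aeval_num h p c : aeval h p (ANum c) = c. Proof. by []. Qed.

Lemma aeval_pid h p : aeval h p APid = p. Proof. by []. Qed.

Lemma aeval_in h p e : aeval h p (AIn e) = input I (aeval h p e).
Proof. by rewrite /=; case: ltnP => // /input_oversize ->. Qed.

Lemma aeval_base h p : aeval h p ABase = B. Proof. exact: base_input. Qed.

Lemma aeval_arr h p j e : aeval h p (AArr j e) = h j (aeval h p e).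
Proof. by []. Qed.

Lemma aeval_bin h p o e1 e2 :
  aeval h p (ABin o e1 e2) = eval_op o (aeval h p e1) (aeval h p e2).
Proof. by []. Qed.

Definition eval_opE :=
  ((fun x y => erefl : eval_op OAdd x y = x + y),
   (fun x y => erefl : eval_op OSub x y = x - y),
   (fun x y => erefl : eval_op OMul x y = x * y),
   (fun x y => erefl : eval_op ODiv x y = x %/ y),
   (fun x y => erefl : eval_op OMod x y = x %% y),
   (fun x y => erefl : eval_op OLt x y = (x < y) :> nat),
   (fun x y => erefl : eval_op OEq x y = (x == y) :> nat)).

Definition aevalE := (aeval_num, aeval_pid, aeval_in, aeval_base, aeval_arr,
  aeval_bin, eval_opE, input_napp, input_npost,
  mul_neq0, add_gt0, bool_neq0, eqb0, negbK, addn1, ltnS).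

Ltac aev := cbv beta; rewrite ?aevalE.

Lemma N_ge_n : n <= N. Proof. by rewrite /instance_size -addnA leq_addr. Qed.

Lemma ltB_le_W x : x < B -> x <= W.
Proof. by move=> /ltnW /leq_trans; apply; apply: leq_trans BW; apply: leq_addr. Qed.

Lemma app_lt a : a < B.
Proof. by rewrite (leq_trans (ltn_ord a)) // (leq_trans N_ge_n) // !leqW. Qed.

Lemma pow_lt_P k x : k <= 4 -> x < B ^ k -> x < P.
Proof.
by move=> k4 xk; apply: (leq_trans xk); apply: leq_trans BP; rewrite leq_pexp2l.
Qed.

Lemma lt_P x : x < B -> x < P.
Proof. by move=> xB; apply: (@pow_lt_P 1); rewrite ?expn1. Qed.

Lemma digit2_lt_P x y : x < B -> y < B -> x * B + y < P.
Proof. by move=> xB yB; apply: (@pow_lt_P 2) => //; apply: digit_lt; rewrite ?expn1. Qed.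

Lemma digit3_lt_P x y z : x < B -> y < B -> z < B -> (x * B + y) * B + z < P.
Proof.
move=> xB yB zB; apply: (@pow_lt_P 3) => //; do 2 apply: digit_lt => //.
Qed.

Lemma digit4_lt_P w x y z : w < B -> x < B -> y < B -> z < B ->
  ((w * B + x) * B + y) * B + z < P.
Proof.
move=> wB xB yB zB; apply: (@pow_lt_P 4) => //; do 3 apply: digit_lt => //.
Qed.

Lemma post_code_ltB (q : post I) : post_code q < B.
Proof.
apply: leq_trans (post_code_lt q) _.
by rewrite !leqW // /instance_size leq_addr.
Qed.

(** The program's graph has all numbers below [B] as vertices; those that code no post are
    isolated. *)
Definition code (q : post I) : 'I_B := Ordinal (post_code_ltB q).

Lemma code_inj : injective code.
Proof. by move=> p q /(congr1 val) /post_code_inj. Qed.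

Definition frame (j : arr) (h h' : arrays) : Prop :=
  forall j', arr_code j' != arr_code j -> h' j' = h j'.

Definition has_first h : Prop := forall a, h First a = code (fpost a).

Definition has_second h : Prop := forall a, h Second a = code (spost a).

Definition has_alive h (D : pred 'I_n) : Prop := forall a, (h Alive a != 0) = D a.

Lemma wp_first h Q :
  (forall h', has_first h' -> frame First h h' -> Q h') -> wp step_first 1 h Q.
Proof.
move=> q; apply: wp_upd => [p _|h' hE fr].
  aev; apply: ltB_le_W; apply: (leq_ltn_trans (input_le _ _)).
  by rewrite ltnS !leqW.
apply: q => // a; rewrite hE; apply: (@first_write_eq _ _ _ _ _ _ _ a) => //.
- exact: lt_P (app_lt a).
- by aev.
move=> p _; aev => ->; rewrite input_offset; last exact: ltnW.
have pa : 0 < size (pref a) by case: (pref a) (pref_nonempty a).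
case E : (pref a) pa => [//|x0 r] pa.
rewrite -[offset _ _]addn0 (@input_pref _ _ _ x0); last by rewrite E.
by rewrite (fpostE _ x0) E.
Qed.

Lemma wp_is_first h Q : has_first h -> (forall i, h IsFirst i = 0) ->
  (forall h', (forall p : 'I_m, (h' IsFirst p == 0) = ~~ is_fpost (inl p : post I)) ->
     frame IsFirst h h' -> Q h') ->
  wp step_is_first 1 h Q.
Proof.
move=> hf h0 q; apply: wp_upd => [p _|h' hE fr]; first exact: ltB_le_W.
apply: q => // p; rewrite hE; case: first_writeP => [x _ gx xp _|un].
  have xn : x < n by move: gx; aev.
  suff -> : is_fpost (inl p : post I) by [].
  apply/existsP; exists (Ordinal xn); apply/eqP/post_code_inj.
  by rewrite -[RHS]xp -[LHS](hf (Ordinal xn)).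
rewrite h0 eqxx; apply/esym/existsPn => a; apply/negP => /eqP ap.
apply: (un a); first exact: lt_P (app_lt a).
  by aev.
by rewrite /= hf ap.
Qed.

Lemma wp_second_last h Q :
  (forall h', (forall a, h' Second a = m + a) -> frame Second h h' -> Q h') ->
  wp step_second_last 1 h Q.
Proof.
move=> q; apply: wp_upd => [p|h' hE fr].
  aev => pn; apply: ltB_le_W.
  rewrite ltnS; do 2 apply: leqW; rewrite addnC; apply: leq_trans (leq_addr _ _).
  by rewrite leq_add2r ltnW.
apply: q => // a; rewrite hE; apply: (@first_write_eq _ _ _ _ _ _ _ a) => //.
- exact: lt_P (app_lt a).
- by aev.
by move=> p _; aev => ->.
Qed.

Lemma wp_second h Q :
  (forall p : 'I_m, (h IsFirst p == 0) = ~~ is_fpost (inl p : post I)) ->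
  (forall a, h Second a = m + a) ->
  (forall h', has_second h' -> frame Second h h' -> Q h') ->
  wp step_second 1 h Q.
Proof.
move=> isf h0 q; apply: wp_upd => [p _|h' hE fr].
  aev; apply: ltB_le_W; apply: (leq_ltn_trans (input_le _ _)).
  by rewrite ltnS !leqW.
apply: q => // a; rewrite hE.
set g := fun p => aeval h p _ != 0.
have gE p : p %/ B = a -> g p =
    [&& offset I a <= p %% B, p %% B < offset I a.+1 &
        h IsFirst (input I (3 + n + p %% B)) == 0].
  move=> pa; rewrite /g; aev; rewrite pa ltn_ord.
  rewrite (@input_offset I a) ?(@input_offset I a.+1) ?ltn_ord //.
    by rewrite /= -!andbA.
  exact: ltnW.
have [x0 _] : exists x0 : 'I_m, x0 \in pref a.
  by case: (pref a) (pref_nonempty a) => // x0 r; exists x0; rewrite inE eqxx.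
have isfE c : c < size (pref a) ->
    (h IsFirst (input I (3 + n + (offset I a + c))) == 0) =
    ~~ is_fpost (inl (nth x0 (pref a) c) : post I).
  by move=> lt; rewrite (input_pref x0 lt) isf.
have posB c : c < size (pref a) -> offset I a + c < B.
  move=> lt; apply: (@leq_trans (offset I a.+1)); first by rewrite offsetS ltn_add2l.
  by rewrite (leq_trans (offset_le _ _)) // !leqW // leq_addl.
case: first_writeP => [p pP gp|un].
  aev => pa min.
  move: gp; rewrite gE // => /and3P [ge lt nf].
  have pc : p %% B = offset I a + (p %% B - offset I a) by rewrite subnKC.
  move: lt nf; rewrite pc; set c := _ - _; rewrite offsetS ltn_add2l => cs.
  rewrite isfE // => nf; rewrite (input_pref x0 cs) (@spost_nth _ _ c x0) //.
  move=> c' c'c; apply: contraT => nf'.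
  have c's : c' < size (pref a) by apply: ltn_trans cs.
  (* An eligible position [c'] before [c] would belong to a processor of smaller index writing to
     the same cell. *)
  have := min (a * B + (offset I a + c')).
  rewrite digit2_lt_P ?app_lt ?posB // gE ?digit_div ?digit_mod ?posB //.
  rewrite leq_addr offsetS ltn_add2l c's isfE // nf' /=.
  rewrite base_input digit_div ?posB // => /(_ isT isT erefl).
  by rewrite leqNgt [X in _ < X](divn_eq p B) pa pc -/c !ltn_add2l c'c.
(* Without a writer, the cell keeps the last resort post stored by [step_second_last]. *)
rewrite h0 (@spost_none _ a x0) // => c lt; apply: contraT => nf.
case: (un (a * B + (offset I a + c))).
- by rewrite digit2_lt_P ?app_lt ?posB.
- rewrite gE ?digit_div ?digit_mod ?posB // leq_addr offsetS ltn_add2l lt.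
  by rewrite isfE.
- by aev; rewrite digit_div ?posB.
Qed.

Lemma wp_alive h Q :
  (forall h', has_alive h' predT -> frame Alive h h' -> Q h') ->
  wp step_alive 1 h Q.
Proof.
move=> q; apply: wp_upd => [p _|h' hE fr]; first exact: ltB_le_W.
apply: q => // a; rewrite hE (@first_write_eq _ _ _ _ _ _ 1 a) //.
- exact: lt_P (app_lt a).
- by aev.
Qed.

Notation ix k x y := ((k * B + x) * B + y).

Definition fcode a : 'I_B := code (fpost a).

Definition scode a : 'I_B := code (spost a).

(** [k] is a number rather than an applicant, so that [k = n] can stand for deleting nothing. *)
Definition all_but (D : pred 'I_n) (k : nat) : pred 'I_n :=
  [pred b : 'I_n | D b && (b != k :> nat)].

Lemma ix_inj k k' (x y x' y' : 'I_B) :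
  ix k x y = ix k' x' y' -> [/\ k = k', x = x' & y = y'].
Proof.
move=> /digit_inj - /(_ (ltn_ord _) (ltn_ord _)) [/digit_inj].
by move=> /(_ (ltn_ord _) (ltn_ord _)) [-> /val_inj -> /val_inj ->].
Qed.

Lemma wp_diag h Q :
  (forall h', (forall k (x y : 'I_B), k < B -> (h' Reach (ix k x y) != 0) = (x == y)) ->
     frame Reach h h' -> Q h') ->
  wp step_diag 1 h Q.
Proof.
move=> q; apply: wp_upd => [p _|h' hE fr].
  by aev; apply: ltB_le_W; apply: (leq_ltn_trans (leq_b1 _)).
apply: q => // k x y kB; rewrite hE.
rewrite (@first_write_eq _ _ _ _ _ _ (x == y) (ix k x y)) ?bool_neq0 //.
  exact: digit3_lt_P.
by move=> p _; aev => ->; rewrite digit_div // !digit_mod.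
Qed.

Lemma wp_edge j j' (f1 f2 : 'I_n -> 'I_B) D h Q :
  (forall a, h j a = f1 a) -> (forall a, h j' a = f2 a) -> has_alive h D ->
  (forall h', (forall k (x y : 'I_B), k < B -> (h' Reach (ix k x y) != 0) =
        (h Reach (ix k x y) != 0) ||
        [exists b, all_but D k b && ((f1 b == x) && (f2 b == y))]) ->
     frame Reach h h' -> Q h') ->
  wp (step_edge j j') 1 h Q.
Proof.
move=> h1 h2 hD q; apply: wp_upd => [p _|h' hE fr]; first exact: ltB_le_W.
apply: q => // k x y kB; rewrite hE; case: first_writeP => [p _|un].
  aev => gp pE _; apply/esym/orP; right; apply/existsP.
  case/andP: gp => /andP [pn al pk].
  pose b := Ordinal pn; have pb : p %% B = b by [].
  exists b; rewrite pb h1 h2 in pE; have [<- <- <-] := ix_inj pE.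
  by rewrite !eqxx andbT /all_but /= -hD -pb al pk.
case: existsP => [[b /andP [/andP [Db bk] /andP [/eqP bx /eqP yb]]]|_]; last by rewrite orbF.
case: (un (k * B + b)).
- by rewrite digit2_lt_P ?app_lt.
- by aev; rewrite digit_div ?digit_mod ?app_lt // ltn_ord hD Db bk.
- by aev; rewrite digit_div ?digit_mod ?app_lt // h1 h2 bx yb.
Qed.

Lemma wp_square h Q :
  (forall h', (forall k (x z : 'I_B), k < B -> (h' Reach (ix k x z) != 0) =
        (h Reach (ix k x z) != 0) ||
        [exists y : 'I_B, (h Reach (ix k x y) != 0) && (h Reach (ix k y z) != 0)]) ->
     frame Reach h h' -> Q h') ->
  wp step_square 1 h Q.
Proof.
move=> q; apply: wp_upd => [p _|h' hE fr]; first exact: ltB_le_W.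
apply: q => // k x z kB; rewrite hE; case: first_writeP => [p _|un].
  aev => gp pE _; apply/esym/orP; right; apply/existsP.
  have modB i : i %% B < B by rewrite ltn_mod.
  exists (Ordinal (modB (p %/ B))).
  move: pE; rewrite -[p %% B]/(val (Ordinal (modB p))) => /digit_inj.
  move=> /(_ (ltn_ord _) (ltn_ord _)) [hi lo].
  move: gp; rewrite {1}(divn_eq (p %/ B) B) hi.
  by rewrite -lo /= digit_div.
case: existsP => [[y /andP [xy yz]]|_]; last by rewrite orbF.
case: (un (ix k x y * B + z)).
- exact: digit4_lt_P.
- by aev; rewrite !digit_div ?digit_mod // xy yz.
- by aev; rewrite !digit_div ?digit_mod.
Qed.

Lemma wp_scratch (i v : nat) e h Q :
  (forall p, aeval h p e = v) -> v <= W ->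
  (forall h', h' Scratch i = v -> frame Scratch h h' -> Q h') ->
  wp (upd Scratch 1 i e) 1 h Q.
Proof.
move=> ev vW q; apply: wp_upd => [p _|h' hE fr]; first by rewrite ev.
apply: q => //; rewrite hE; apply: (@first_write_eq _ _ _ _ _ _ _ 0) => //.
exact: lt_P.
Qed.

Definition reaches h (D : pred 'I_n) : Prop :=
  forall k (x y : 'I_B), k < B ->
    (h Reach (ix k x y) != 0) = conn fcode scode (all_but D k) x y.

Lemma wp_closure l D h Q : B <= 2 ^ l ->
  has_first h -> has_second h -> has_alive h D ->
  (forall h', reaches h' D ->
     (forall j, arr_code j != arr_code Reach -> arr_code j != arr_code Scratch ->
        h' j = h j) -> Q h') ->
  wp closure (l * 3 + 5) h Q.
Proof.
move=> Bl hf hs hD q.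
pose adjk k := adj fcode scode (all_but D k).
pose R h' k : rel 'I_B := fun x y => h' Reach (ix k x y) != 0.
pose fr h' := forall j, arr_code j != arr_code Reach ->
  arr_code j != arr_code Scratch -> h' j = h j.
(* With [i] rounds left, [i] further doublings bring the length to [B]. The relations are sound, and
   complete up to the current length, for every deleted edge [k] at once. *)
pose J i h' := [/\ B <= h' Scratch 0 * 2 ^ i, fr h',
  forall k x y, k < B -> R h' k x y -> conn fcode scode (all_but D k) x y
  & forall k, k < B -> covers (adjk k) (h' Scratch 0) (R h' k)].
(* Four instructions precede the loop; a round consists of a test, a squaring and a doubling. *)
have -> : l * 3 + 5 = 1 + (1 + (1 + (1 + (l * 3 + 1)))) by rewrite addnC (addnC (l * 3) 1).
apply: wp_seq; apply: wp_diag => h1 R1 fr1.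
apply: wp_seq; apply: (@wp_edge _ _ fcode scode D) => [a|a|a|h2 R2 fr2];
  rewrite ?fr1 //.
apply: wp_seq; apply: (@wp_edge _ _ scode fcode D) => [a|a|a|h3 R3 fr3];
  rewrite ?fr2 ?fr1 //.
have {}R3 k (x y : 'I_B) : k < B -> R h3 k x y = (x == y) || adjk k x y.
  move=> kB; rewrite /R R3 // R2 // R1 // -orbA; congr (_ || _).
  apply/orP/existsP => [[] /existsP [b /andP [Db bxy]]|[b /andP [Db /orP [] bxy]]].
  - by exists b; rewrite Db /joins bxy.
  - by exists b; rewrite Db /joins bxy orbT.
  - by left; apply/existsP; exists b; rewrite Db.
  - by right; apply/existsP; exists b; rewrite Db.
apply: wp_seq; apply: (@wp_scratch 0 1) => // [|h4 T4 fr4]; first exact: ltB_le_W.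
have R4 k : k < B -> R h4 k =2 R h3 k by move=> kB x y; rewrite /R fr4.
(* On exit the length is at least [B], the number of vertices, so [covers_connect] gives
   completeness. *)
apply: (@wp_mono _ _ _ _ _ _ _ (fun h' => aeval h' 0 (Scratch.[0] < ABase)%A = 0 /\
    exists i, J i h')); first exact: leqnn.
  move=> h' [] /=; rewrite base_input => /eqP; rewrite eqb0 -leqNgt => Bd [i [_ fr' sound cov]].
  apply: q => // k x y kB; apply/idP/idP; first exact: sound.
  by apply: covers_connect (cov k kB); rewrite card_ord.
apply: wp_while => [|h'|i h' [BT fr' sound cov] /=].
- rewrite /J T4 mul1n; split=> // [j jR jS|k x y kB|k kB].
  + by rewrite fr4 // fr3 // fr2 // fr1.
  + rewrite R4 // R3 // => /orP [/eqP ->|]; first exact: connect0.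
    exact: connect1.
  + move=> x [|y [|//]] /=; rewrite R4 // R3 // ?eqxx //.
    by rewrite andbT => ->; rewrite orbT.
- by rewrite /J muln1 /= base_input => [[le _ _ _]]; rewrite ltnNge le.
rewrite base_input; case: ltnP => // T_lt_B _.
rewrite -[2]/(1 + 1); apply: wp_seq; apply: wp_square => h5 R5 fr5.
apply: (@wp_scratch 0 (h' Scratch 0 + h' Scratch 0)) => [p|| h6 T6 fr6].
- by rewrite /= fr5.
- by apply: leq_trans BW; rewrite leq_add // ltnW.
have R6 k : k < B -> R h6 k =2 R h5 k by move=> kB x y; rewrite /R fr6.
split=> [|j jR jS|k x y kB|k kB].
- by rewrite T6 addnn -muln2 -mulnA -expnS.
- by rewrite fr6 // fr5 // fr'.
- rewrite R6 // /R R5 // => /orP [|/existsP [z /andP [xz zy]]]; first exact: sound.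
  by apply: connect_trans (sound _ _ _ kB xz) (sound _ _ _ kB zy).
rewrite T6; apply: covers_double (cov k kB) => x y z xy yz.
rewrite R6 // /R R5 //; apply/orP; right; apply/existsP; exists y.
by rewrite -/(R h' k x y) -/(R h' k y z) xy yz.
Qed.

Definition nonbridge b : bool :=
  conn fcode scode (predC1 b) (fcode b) (scode b).

Definition lead_spec (lead : 'I_n -> 'I_n) : Prop :=
  leads fcode scode (@spost_last I) nonbridge (@nat_of_ord n) B lead.

Lemma reach_edge h D (a b c : 'I_n) : reaches h D -> has_first h -> has_second h ->
  (h Reach (ix a (h First b) (h Second c)) != 0) =
  conn fcode scode (sans a D) (fcode b) (scode c).
Proof. by move=> hR hf hs; rewrite hf hs (hR a (fcode b)) ?app_lt. Qed.

Lemma reach_nonbridge h a : reaches h predT -> has_first h -> has_second h ->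
  (h Reach (ix a (h First a) (h Second a)) != 0) = nonbridge a.
Proof. by move=> hR hf hs; rewrite (reach_edge _ _ _ hR) //; apply: conn_eq. Qed.

Lemma wp_leader h Q : has_first h -> has_second h -> reaches h predT ->
  (forall h' lead, lead_spec lead -> (forall a, h' Leader a = lead a) ->
     frame Leader h h' -> Q h') ->
  wp step_leader 1 h Q.
Proof.
move=> hf hs hR q; apply: wp_upd => [p _|h' hE fr].
  by aev; apply/ltB_le_W/ltn_mod.
set g := fun p => _ in hE.
have gE p b a : p %/ B %% B = b -> p %% B = a ->
    g p = candidate fcode scode (@spost_last I) nonbridge (p %/ B %/ B) b a.
  move=> pb pa; rewrite /g; aev; rewrite pa pb !ltn_ord /=.
  rewrite reach_nonbridge // !hf hs (hR n (fcode b)); last first.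
    by rewrite ltnS (leq_trans N_ge_n) // !leqW.
  rewrite /candidate andbA; congr (_ && _ && _); last by rewrite (@post_code_last I b) ?mem_spost.
  by apply: conn_eq => c; rewrite /all_but /= neq_ltn ltn_ord.
have gE' c b a : g (ix c b a) = candidate fcode scode (@spost_last I) nonbridge c b a.
  by rewrite (gE _ b a) ?digit_div ?digit_mod ?app_lt.
(* In class 2 every applicant is a candidate for itself, so each leader cell is written. *)
have lastc a : candidate fcode scode (@spost_last I) nonbridge 2 a a.
  by rewrite /candidate conn_refl.
have /fin_all_exists [lead leadP] a : exists b : 'I_n, h' Leader a = b /\
    exists c, candidate fcode scode (@spost_last I) nonbridge c b a /\
      forall c' b', candidate fcode scode (@spost_last I) nonbridge c' b' a ->
      c * B + b <= c' * B + b'.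
  rewrite hE; case: first_writeP => [p pP gp|un]; last first.
    case: (un ((2 * B + a) * B + a)).
    - by rewrite digit3_lt_P ?app_lt.
    - by rewrite gE'.
    - by aev; rewrite digit_mod ?app_lt.
  aev => pa min.
  have bn : p %/ B %% B < n by move: gp; rewrite /g; aev; rewrite -!andbA => /and3P [].
  exists (Ordinal bn); split=> //; exists (p %/ B %/ B); split; first by rewrite -gE.
  (* All writers to cell [a] share the last digit, so the least processor also has the least
     quotient by [B], which is the key. *)
  have key c' b' : c' < B -> candidate fcode scode (@spost_last I) nonbridge c' b' a ->
      p %/ B <= c' * B + b'.
    move=> c'B cand; rewrite -(@digit_div B (c' * B + b') a) ?app_lt // leq_div2r //.
    apply: min; first by rewrite digit3_lt_P ?app_lt.
    - by rewrite gE'.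
    - by aev; rewrite digit_mod ?app_lt.
  (* Classes from [B] on may exceed the available processors, but the class 2 key of [a] is at most
     [3 * B] and thus no larger. *)
  move=> c' b' cand; rewrite /= -divn_eq; case: (ltnP c' B) => [/key|le]; first exact.
  apply: leq_trans (key 2 a _ (lastc a)) _ => //.
  apply: (@leq_trans (3 * B)); first by rewrite (mulSn 2) addnC leq_add2r ltnW ?app_lt.
  by apply: leq_trans (leq_addr _ _); rewrite leq_mul2r (leq_trans _ le).
by apply: (q h' lead) => // a; have [] := leadP a.
Qed.

Lemma wp_kill h (lead : 'I_n -> 'I_n) Q : has_first h -> has_second h -> reaches h predT ->
  has_alive h predT -> (forall a, h Leader a = lead a) ->
  (forall h', has_alive h' (alive nonbridge lead) -> frame Alive h h' -> Q h') ->
  wp step_kill 1 h Q.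
Proof.
move=> hf hs hR ha hl q; apply: wp_upd => [p _|h' hE fr]; first exact: ltB_le_W.
have gE a : (aeval h a ((APid < a_napp) * a_joined APid APid *
    (Leader.[APid] == APid))%A != 0) = ~~ alive nonbridge lead a.
  by aev; rewrite ltn_ord reach_nonbridge // hl /alive /=.
apply: q => // a; rewrite hE; case: first_writeP => [p _ gp pa _|un].
  have {}pa : p = a by [].
  by apply/esym/negbTE; rewrite -gE -pa.
rewrite ha; apply/esym; apply: contraT; rewrite -gE => ga.
by case: (un a) => //; apply: lt_P; apply: app_lt.
Qed.

Definition all_bridges (D : pred 'I_n) : bool :=
  [forall b, D b ==> ~~ conn fcode scode (sans b D) (fcode b) (scode b)].

Lemma wp_check h D Q : has_first h -> has_second h -> reaches h D ->
  has_alive h D -> h Scratch 1 = 1 ->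
  (forall h', h' Scratch 1 = all_bridges D -> frame Scratch h h' -> Q h') ->
  wp step_check 1 h Q.
Proof.
move=> hf hs hR ha h1 q; apply: wp_upd => [p _|h' hE fr]; first exact: ltB_le_W.
have gE b : (aeval h b ((APid < a_napp) * Alive.[APid] * a_joined APid APid)%A != 0) =
    D b && conn fcode scode (sans b D) (fcode b) (scode b).
  by aev; rewrite ltn_ord (reach_edge _ _ _ hR) // ha.
apply: q => //; rewrite hE; case: first_writeP => [p _ gp _ _|un].
  have pn : p < n by move: gp; aev; rewrite -!andbA => /and3P [].
  move: gp; rewrite -[p]/(val (Ordinal pn)) gE => /andP [Db bb].
  suff -> : all_bridges D = false by [].
  by apply/forallP => /(_ (Ordinal pn)); rewrite Db bb.
suff -> : all_bridges D by [].
apply/forallP => b; apply/implyP => Db; apply/negP => bb.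
by case: (un b); rewrite ?gE ?Db //; apply: lt_P; apply: app_lt.
Qed.

Lemma run_output h s D (lead : 'I_n -> 'I_n) : rep W (input I) h s ->
  has_first h -> has_second h -> reaches h D -> (forall a, h Leader a = lead a) ->
  exists s', [/\ run P W step_output s 1 s', s' 0 = h Scratch 1
    & forall a, s' a.+1 = if conn fcode scode (sans a D) (scode (lead a)) (fcode a)
        then code (spost a) else code (fpost a)].
Proof.
move=> hrep hf hs hR hl; have [_ arrE sW] := hrep.
have hW j i : h j i <= W by rewrite -arrE sW.
set s' := par_step P (comp (APid <= a_napp)) (comp APid) (comp a_output) s.
have sE x : s' x = first_write P (fun p => aeval h p (APid <= a_napp)%A != 0)
    (fun p => p) (fun p => aeval h p a_output) s x.
  rewrite /s' /par_step /first_write.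
  under eq_filter do rewrite !(eval_comp _ _ hrep).
  by case: filter => // p _; rewrite (eval_comp _ _ hrep).
exists s'; split.
- apply: run_par => x; rewrite -/s' sE; case: first_writeP => // p _ _ _ _.
  (* Exactly one product in [a_output] survives, so the value is a single array entry and inherits
     its bound. *)
  aev; case: p => [|p]; first by rewrite /= mul1n mul0n addn0.
  rewrite mul0n mul1n add0n.
  by case: posnP => _; rewrite ?mul0n ?mul1n ?addn0 ?add0n.
- rewrite sE (@first_write_eq _ _ _ _ _ _ (h Scratch 1) 0) //.
  + exact: lt_P.
  + by aev; rewrite orbT.
  + by move=> p _ ->; aev; rewrite mul1n mul0n addn0.
move=> a; rewrite sE; apply: (@first_write_eq _ _ _ _ _ _ _ a.+1) => //.
- by apply: lt_P; rewrite ltnS (leq_trans (ltn_ord a)) // (leq_trans N_ge_n) // !leqW.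
- by aev.
move=> p _ ->; aev; rewrite subn1 /= mul0n mul1n add0n hl hf hs.
have -> : conn fcode scode (sans a D) (scode (lead a)) (fcode a) =
    (h Reach (ix a (scode (lead a)) (fcode a)) != 0) by rewrite hR ?app_lt.
by rewrite lt0n; case: eqP => _; rewrite ?mul0n ?mul1n ?addn0 ?add0n.
Qed.

End Verification.

(** * The theorem *)

Section Main.
Variables (I : instance) (P W : nat).
Notation n := (napp I).
Notation N := (instance_size I).
Notation B := (instance_size I).+3.
Hypotheses (BP : B ^ 4 <= P) (BW : B + B <= W).
Notation nonbridge := (@nonbridge I).
Notation fcode := (@fcode I).
Notation scode := (@scode I).

Definition decided (h : arrays) (lead : 'I_n -> 'I_n) : Prop :=
  [/\ has_first I h /\ has_second I h, reaches h (alive nonbridge lead),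
      lead_spec lead, forall a : 'I_n, h Leader a = lead a
    & h Scratch 1 = all_bridges (alive nonbridge lead)].

Lemma wp_decide l h : B <= 2 ^ l -> (forall j i, h j i = 0) ->
  wp P W (input I) decide_prog (l * 6 + 19) h (fun h' => exists lead, decided h' lead).
Proof.
move=> Bl h0; set c := l * 3 + 5.
(* Two closures and nine single instructions. *)
have -> : l * 6 + 19 = 1 + (1 + (1 + (1 + (1 + (c + (1 + (1 + (c + (1 + 1))))))))).
  by rewrite /c; lia.
apply: wp_seq; apply: wp_first => // h1 f1 fr1.
apply: wp_seq; apply: (wp_is_first BP BW f1) => [i|h2 i2 fr2]; first by rewrite fr1.
apply: wp_seq; apply: wp_second_last => // h3 s3 fr3.
apply: wp_seq; apply: wp_second => // [p|h4 s4 fr4]; first by rewrite fr3.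
apply: wp_seq; apply: wp_alive => // h5 a5 fr5.
have f5 : has_first I h5 by move=> a; rewrite fr5 // fr4 // fr3 // fr2.
have s5 : has_second I h5 by move=> a; rewrite fr5.
apply: wp_seq; apply: (wp_closure _ _ Bl f5 s5 a5) => // h6 r6 fr6.
have f6 : has_first I h6 by move=> a; rewrite fr6.
have s6 : has_second I h6 by move=> a; rewrite fr6.
have a6 : has_alive h6 (predT : pred 'I_n) by move=> a; rewrite fr6.
apply: wp_seq; apply: wp_leader => // h7 lead leadP l7 fr7.
have f7 : has_first I h7 by move=> a; rewrite fr7.
have s7 : has_second I h7 by move=> a; rewrite fr7.
have a7 : has_alive h7 (predT : pred 'I_n) by move=> a; rewrite fr7.
have r7 : reaches h7 (predT : pred 'I_n) by move=> k x y kB; rewrite fr7 // r6.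
apply: wp_seq; apply: (wp_kill _ _ f7 s7 r7 a7 l7) => // h8 a8 fr8.
have f8 : has_first I h8 by move=> a; rewrite fr8.
have s8 : has_second I h8 by move=> a; rewrite fr8.
apply: wp_seq; apply: (wp_closure _ _ Bl f8 s8 a8) => // h9 r9 fr9.
apply: wp_seq; apply: (@wp_scratch _ _ _ _ _ 1 1) => // [|h10 o10 fr10].
  exact: leq_trans BW.
have f10 : has_first I h10 by move=> a; rewrite fr10 // fr9.
have s10 : has_second I h10 by move=> a; rewrite fr10 // fr9.
have a10 : has_alive h10 (alive nonbridge lead) by move=> a; rewrite fr10 // fr9.
have r10 : reaches h10 (alive nonbridge lead) by move=> k x y kB; rewrite fr10 // r9.
apply: (wp_check _ _ f10 s10 r10 a10) => // h11 o11 fr11.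
exists lead; split=> // [|k x y kB|a]; first by split=> a; rewrite fr11.
  by rewrite fr11 // r10.
by rewrite fr11 // fr10 // fr9 // fr8.
Qed.

Lemma sel_code y a : sel fcode scode y a = code (sel (@fpost I) (@spost I) y a).
Proof. by rewrite /sel; case: (y a). Qed.

Lemma decided_output h lead s :
  decided h lead -> s 0 = h Scratch 1 ->
  (forall a : 'I_n, s a.+1 =
    if conn fcode scode (sans a (alive nonbridge lead)) (scode (lead a)) (fcode a)
    then code (spost a) else code (fpost a)) ->
  max_popular_output I s.
Proof.
move=> [_ _ leadP _ flag] s0 sM.
have fNs a b : fcode a != scode b by rewrite (inj_eq (@code_inj I)) fpost_neq_spost.
have lr_inj a b : spost_last a -> scode b = scode a -> b = a.
  by move=> la /code_inj; apply: spost_last_inj.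
have ltB (a : 'I_n) : a < B by apply: app_lt.
have lconn := leads_conn leadP.
have leq := leads_eq (@ord_inj n) ltB leadP.
have lnb := leads_nb ltB leadP.
have llr := leads_lr ltB leadP.
have okP : reflect (orientable fcode scode nonbridge lead)
    (all_bridges (alive nonbridge lead)).
  apply: (iffP forallP) => ok b; first by move=> alb; have := ok b; rewrite alb.
  by apply/implyP => /ok.
have inj_code y : injective (sel (@fpost I) (@spost I) y) <-> injective (sel fcode scode y).
  split=> inj a b; first by rewrite !sel_code => /code_inj /inj.
  by move=> e; apply: inj; rewrite !sel_code e.
(* A popular matching is an orientation with in-degrees at most 1. This gives optimality in one
   branch and non-existence in the other. *)
have sel_inj (M : assignment I) : popular M ->
    injective (sel fcode scode (fun a => M a == spost a)).
  move=> popM; apply/inj_code => a b; rewrite -!(popular_sel popM).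
  by case: popM => [[injM _] _]; apply: injM.
case: okP flag => [ok | nok] flag; [left | right].
  split; first by rewrite s0 flag.
  pose y := orient fcode scode nonbridge lead.
  have injy : injective (sel fcode scode y) by apply: sel_orient_inj.
  pose M : assignment I := [ffun a => sel (@fpost I) (@spost I) y a].
  exists M; split; last first.
    by move=> a; rewrite sM ffunE /sel /y /orient; case: ifP.
  have popM : popular M.
    apply: sel_popular => [|a]; first exact/inj_code.
    have [b fb] : exists b, sel fcode scode y b = fcode a by apply: orient_f_matched.
    by exists b; move: fb; rewrite sel_code => /code_inj.
  split=> // M' popM'.
  rewrite (matching_size_sel (popular_sel popM')) (@matching_size_sel _ y); last first.
    by move=> a; rewrite ffunE.
  by rewrite leq_add2r; apply: orient_max (sel_inj _ popM').
split; first by rewrite s0 flag.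
by case=> M /sel_inj inj; apply: nok; apply: orientable_of_inj inj.
Qed.

Lemma run_popular_prog l : B <= 2 ^ l -> exists t s,
  [/\ run P W popular_prog (input I) t s, t <= l * 6 + 20
    & max_popular_output I s].
Proof.
move=> Bl; pose h0 : arrays := fun _ _ => 0.
(* Memory beyond the input is zero, which provides the cleared [IsFirst] array that [wp_is_first]
   needs. *)
have rep0 : rep W (input I) h0 (input I).
  split=> // [j i|x]; first by rewrite input_oversize // leq_addr.
  apply: leq_trans (input_le _ _) _; apply: leq_trans BW.
  by rewrite -addn3 -addnA leq_addr.
have [t [s [h [r tl hrep [lead dec]]]]] := @wp_decide l h0 Bl (fun _ _ => erefl) _ rep0.
have [[f s2] rc _ ll _] := dec.
have [s' [r' s0 sM]] := run_output BP hrep f s2 rc ll.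
exists (t + 1), s'; split; first exact: run_seq r r'.
  by rewrite addn1 (addnS _ 19) ltnS.
exact: decided_output dec s0 sM.
Qed.

End Main.

(** * Numerical bounds *)

Lemma processors_bound N : N.+3 ^ 4 <= poly_bound 256 N.
Proof.
rewrite /poly_bound; case: N => [|N].
  by apply: leq_trans (leq_addl _ _).
apply: (@leq_trans (256 * N.+1 ^ 256)); last exact: leq_addr.
(* For a positive size, adding 3 at most quadruples it, and 256 is [4 ^ 4]. *)
apply: (@leq_trans ((4 * N.+1) ^ 4)).
  by rewrite leq_exp2r // mulSn addSn; lia.
by rewrite expnMn leq_mul // leq_pexp2l.
Qed.

Lemma words_bound N : N.+3 + N.+3 <= poly_bound 6 N.
Proof.
rewrite /poly_bound; have : N <= N ^ 6 by case: N => // N; rewrite -{1}[N.+1]expn1 leq_pexp2l.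
lia.
Qed.

Lemma time_bound N : (trunc_log 2 N + 3) * 6 + 20 <= polylog_bound 38 N.
Proof.
(* The left side is [6 * l + 38], whence the constant. *)
rewrite /polylog_bound; set l := trunc_log 2 N.
have : l <= l ^ 38 by case: l => // l; rewrite -{1}[l.+1]expn1 leq_pexp2l.
move: (l ^ 38) => x; lia.
Qed.

(** This bounds the number of doublings that take the path length from 1 to [N.+3]. *)
Lemma rounds_bound N : N.+3 <= 2 ^ (trunc_log 2 N + 3).
Proof.
have : N < 2 ^ (trunc_log 2 N).+1 by apply: trunc_log_ltn.
rewrite addn3 !expnS; move: (2 ^ _) => x; lia.
Qed.

Theorem theorem7 :
  NC_solvable instance_size encode_instance max_popular_output.
Proof.
exists popular_prog, 256, 6, 38 => I.
have [t [s [r tl out]]] := run_popular_prog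
  (processors_bound (instance_size I)) (words_bound (instance_size I))
  (rounds_bound (instance_size I)).
exists t, s; split=> //.
exact: leq_trans tl (time_bound _).
Qed.
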